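(* Assume one of the hypotheses H1, H2, H3, H4 spelled out in the context, with associated $r$, $\eta$, $\mathcal{X}$, $\mathcal{Y}$, $Q$. Further assume $\mathrm{Var}[Q]\le1$, $\deg(Q)\le d$, and $\mathrm{Inf}_i(Q)\le\tau$ for all $i$. Let $\Psi:\mathbb{R}\to\mathbb{R}$ be a $\mathcal{C}^r$ function with $|\Psi^{(r)}|\le B$ uniformly. Then $$\Bigl|\mathbf{E}[\Psi(Q(\mathcal{X}))]-\mathbf{E}[\Psi(Q(\mathcal{Y}))]\Bigr|\le\epsilon,$$ where $$\epsilon=\begin{cases}(2B/r!)\,d\,\eta^{-rd}\,\tau^{r/2-1}&\text{under H1},\\ B\,30^d\,\beta^d\,\tau^{1/2}&\text{under H2},\\ B\,(10\alpha^{-1/2})^d\,\tau^{1/2}&\text{under H3},\\ B\,10^d\,\tau&\text{under H4}.\end{cases}$$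
   Context: Ensembles. An orthonormal ensemble is a finite collection of real random variables, orthonormal in $L^2$, one of which is the constant $1$. A sequence of ensembles is $\mathcal{X}=(\mathcal{X}_1,\dots,\mathcal{X}_n)$ with $\mathcal{X}_i=\{X_{i,0}=1,X_{i,1},\dots,X_{i,m_i}\}$ orthonormal ensembles, where $\mathcal{X}_1,\dots,\mathcal{X}_n$ are independent families of random variables; similarly $\mathcal{Y}$ with variables $Y_{i,j}$ (same index sets). Polynomials. A multi-index is $\sigma=(\sigma_1,\dots,\sigma_n)\in\mathbb{N}^n$ ($0\in\mathbb{N}$); $|\sigma|=\#\{i:\sigma_i>0\}$; $x_\sigma=\prod_{i=1}^n x_{i,\sigma_i}$. A multilinear polynomial is $Q(x)=\sum_\sigma c_\sigma x_\sigma$ with real $c_\sigma$, finitely many nonzero (only indices occurring in the ensembles are used); $\deg Q=\max\{|\sigma|:c_\sigma\ne0\}$. $Q(\mathcal{X})$ is the random variable obtained by substituting $X_{i,j}$ for $x_{i,j}$. $\mathrm{Var}[Q]=\sum_{|\sigma|>0}c_\sigma^2$, $\mathrm{Inf}_i(Q)=\sum_{\sigma:\sigma_i>0}c_\sigma^2$. $(T_\rho Q)(x)=\sum_\sigma\rho^{|\sigma|}c_\sigma x_\sigma$. Hypercontractivity. For $1\le p\le q<\infty$, $0<\eta<1$, $\mathcal{X}$ is $(p,q,\eta)$-hypercontractive if $\|(T_\eta Q)(\mathcal{X})\|_q\le\|Q(\mathcal{X})\|_p$ for every multilinear polynomial $Q$ over $\mathcal{X}$. Hypotheses ($Q$ is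 a multilinear polynomial in each): H1: $r\ge3$ is an integer; $\mathcal{X},\mathcal{Y}$ are (independent) sequences of $n$ ensembles which are $(2,r,\eta)$-hypercontractive (so $\eta\le(r-1)^{-1/2}$); and for all $i$ and all finite multisets $\Sigma$ of indices with $|\Sigma|<r$, $\mathbf{E}[\prod_{\sigma\in\Sigma}X_{i,\sigma}]=\mathbf{E}[\prod_{\sigma\in\Sigma}Y_{i,\sigma}]$. H2: $r=3$; each ensemble of $\mathcal{X}$ and $\mathcal{Y}$ has only two variables, $X_{i,0}=1,X_{i,1}=X_i$ (resp. $Y_{i,0}=1,Y_{i,1}=Y_i$); each $X_i$ and each $Y_i$ has mean $0$, second moment $1$ and third absolute moment at most $\beta$; $\eta=2^{-3/2}\beta^{-1/3}$. H3: $r=3$; the variables of $\mathcal{X}_i$ form a basis of the real-valued functions on a finite probability space $\Omega_i$; the least nonzero probability of any atom in any $\Omega_i$ is $\alpha\le1/2$; $\eta=\frac12\alpha^{1/6}$; $\mathcal{Y}$ is any $(2,3,\eta)$-hypercontractive sequence of $n$ ensembles. H4: $r=4$, $\eta=3^{-1/2}$; each ensemble of $\mathcal{X}$ and $\mathcal{Y}$ has only two variables, $1$ and $X_i$ (resp. $1$ and $Y_i$), and each $X_i$ and each $Y_i$ is either a uniform $\pm1$ bit, a standard Gaussian, or uniform on $[-\sqrt3,\sqrt3]$. *)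

(* Defs.v *)
From HB Require Import structures.
From mathcomp Require Import all_boot all_order all_algebra.
From mathcomp Require Import all_classical all_reals all_analysis.

Set Implicit Arguments.
Unset Strict Implicit.
Unset Printing Implicit Defensive.

Import Order.TTheory GRing.Theory Num.Theory.
Import numFieldNormedType.Exports.

Local Open Scope classical_set_scope.
Local Open Scope ring_scope.

(** Multilinear polynomials over the indeterminates x_{i,j} with i < n and
    0 <= j <= m i.  A multi-index picks one j for every i, with j = 0 standing
    for "x_i does not occur"; only finitely many multi-indices use the indices
    available in the ensembles, so a polynomial is a total coefficient
    function on them. *)

Definition multi_index (n : nat) (m : 'I_n -> nat) : finType :=
  {dffun forall i : 'I_n, 'I_(m i).+1}.

Definition mi_size (n : nat) (m : 'I_n -> nat) (s : multi_index m) : nat :=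
  #|[pred i : 'I_n | s i != ord0]|.

Definition mlpoly (R : realType) (n : nat) (m : 'I_n -> nat) :=
  {ffun multi_index m -> R}.

Section MultilinearPolynomials.
Context {R : realType} {n : nat} {m : 'I_n -> nat}.
Implicit Type Q : mlpoly R m.

(* The zero polynomial gets degree 0. *)
Definition ml_deg Q : nat := \max_(s : multi_index m | Q s != 0) mi_size s.

Definition ml_var Q : R :=
  \sum_(s : multi_index m | (0 < mi_size s)%N) Q s ^+ 2.

Definition ml_inf Q (i : 'I_n) : R :=
  \sum_(s : multi_index m | s i != ord0) Q s ^+ 2.

Definition ml_noise (rho : R) Q : mlpoly R m :=
  [ffun s => rho ^+ mi_size s * Q s].

End MultilinearPolynomials.

Section Ensembles.
Context {R : realType} {dT : measure_display} {T : measurableType dT}.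

Definition ensembles (P : probability T R) (n : nat) (m : 'I_n -> nat) :=
  forall i : 'I_n, 'I_(m i).+1 -> {RV P >-> R}.

Context {P : probability T R} {n : nat} {m : 'I_n -> nat}.
Implicit Type X : ensembles P m.

Definition ml_subst (Q : mlpoly R m) X : T -> R :=
  fun t => \sum_(s : multi_index m) Q s * \prod_(i < n) X i (s i) t.

(* Expectations are extended-real valued: the case j = k makes every variable
   square integrable. *)
Definition orthonormal_ensemble (k : nat) (Z : 'I_k.+1 -> {RV P >-> R}) : Prop :=
  (forall t, Z ord0 t = 1) /\
  (forall j k', ('E_P[fun t => (Z j t * Z k' t)%R])%E = ((j == k')%:R)%:E).

(* Independence of the sigma-algebras sigma(X_{i,j} : j), i < n. *)
Definition independent_families X : Prop :=
  forall (J : {set 'I_n}) (A : 'I_n -> set T),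
    (forall i, i \in J ->
       g_sigma_preimage (fun j : 'I_(m i).+1 => X i j : T -> R) (A i)) ->
    P (\bigcap_(i in [set` J]) A i) = (\prod_(i in J) P (A i))%E.

Definition ensemble_sequence X : Prop :=
  (forall i, orthonormal_ensemble (X i)) /\ independent_families X.

Definition hypercontractive (p q eta : R) X : Prop :=
  [/\ 1 <= p <= q,
      0 < eta < 1
    & forall Q : mlpoly R m,
        ('N[P]_(q%:E)[EFin \o ml_subst (ml_noise eta Q) X]
           <= 'N[P]_(p%:E)[EFin \o ml_subst Q X])%E].

(* In a family whose m i all equal 1, the indices j != ord0 single out the
   variable X_i = X_{i,1}. *)
Definition two_variable_ensembles (D : {RV P >-> R} -> Prop) X : Prop :=
  forall i, m i = 1%N /\ (forall j, j != ord0 -> D (X i j)).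

Definition bounded_third_moment (beta : R) (Z : {RV P >-> R}) : Prop :=
  [/\ ('E_P[Z] = 0)%E,
      ('E_P[fun t => (Z t ^+ 2)%R] = 1)%E
    & ('E_P[fun t => (`|Z t| ^+ 3)%R] <= beta%:E)%E].

Definition uniform_bit (Z : {RV P >-> R}) : Prop :=
  P (Z @^-1` [set 1]) = (2^-1 : R)%:E /\ P (Z @^-1` [set -1]) = (2^-1 : R)%:E.

Definition standard_gaussian (Z : {RV P >-> R}) : Prop :=
  forall A : set R, measurable A -> distribution P Z A = normal_prob 0 1 A.

Lemma sqrt3_interval : - Num.sqrt 3 < Num.sqrt 3 :> R.
Proof. by rewrite gtrN// sqrtr_gt0. Qed.

Definition uniform_sqrt3 (Z : {RV P >-> R}) : Prop :=
  forall A : set R, measurable A ->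
    distribution P Z A = uniform_prob sqrt3_interval A.

Definition bit_gaussian_or_uniform (Z : {RV P >-> R}) : Prop :=
  [\/ uniform_bit Z, standard_gaussian Z | uniform_sqrt3 Z].

End Ensembles.

Record finProbSpace (R : realType) := FinProbSpace {
  fps_sort :> finType;
  fps_mass : fps_sort -> R;
  fps_mass_ge0 : forall w, 0 <= fps_mass w;
  fps_mass_sum : \sum_w fps_mass w = 1
}.

Section FiniteSpaces.
Context {R : realType}.

(* Functions on a probability space are identified when they agree almost
   surely, so atoms of mass 0 are ignored. *)
Definition function_basis (Om : finProbSpace R) (k : nat) (f : 'I_k -> Om -> R) : Prop :=
  forall g : Om -> R, exists! a : {ffun 'I_k -> R},
    forall w : Om, fps_mass w != 0 -> g w = \sum_(j < k) a j * f j w.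

Definition least_nonzero_mass (n : nat) (Om : 'I_n -> finProbSpace R) (alpha : R) : Prop :=
  [/\ alpha != 0,
      exists i, exists w : Om i, fps_mass w = alpha
    & forall i (w : Om i), fps_mass w != 0 -> alpha <= fps_mass w].

Context {dT : measure_display} {T : measurableType dT} {P : probability T R}.

(* W is a random point of Om with the law of Om. *)
Definition random_point (Om : finProbSpace R) (W : T -> Om) : Prop :=
  forall w, measurable (W @^-1` [set w]) /\
            P (W @^-1` [set w]) = (fps_mass w)%:E.

(* The ensemble of index i consists of functions of a random point of Om i. *)
Definition bases_of_finite_spaces (n : nat) (m : 'I_n -> nat) (X : ensembles P m)
    (Om : 'I_n -> finProbSpace R) : Prop :=
  forall i, exists W : T -> Om i, exists f : 'I_(m i).+1 -> Om i -> R,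
    [/\ random_point W,
        function_basis f
      & forall j t, X i j t = f j (W t)].

End FiniteSpaces.

Section Hypotheses.
Context {R : realType} {dX dY : measure_display}.
Context {TX : measurableType dX} {TY : measurableType dY}.
Context {PX : probability TX R} {PY : probability TY R}.
Context {n : nat} {m : 'I_n -> nat}.
Implicit Types (X : ensembles PX m) (Y : ensembles PY m).

(* A multiset of indices is listed as a sequence, in any order. *)
Definition matching_moments X Y (r : nat) : Prop :=
  forall (i : 'I_n) (S : seq 'I_(m i).+1), (size S < r)%N ->
    ('E_PX[fun t => (\prod_(j <- S) X i j t)%R]
     = 'E_PY[fun t => (\prod_(j <- S) Y i j t)%R])%E.

Definition hypothesis_H1 X Y (r : nat) (eta : R) : Prop :=
  [/\ (3 <= r)%N,
      hypercontractive 2 r%:R eta X,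
      hypercontractive 2 r%:R eta Y
    & matching_moments X Y r].

Definition hypothesis_H2 X Y (r : nat) (eta beta : R) : Prop :=
  [/\ r = 3%N,
      two_variable_ensembles (bounded_third_moment beta) X,
      two_variable_ensembles (bounded_third_moment beta) Y
    & eta = 2 `^ (- (3 / 2)) * beta `^ (- 3^-1)].

Definition hypothesis_H3 X Y (r : nat) (eta alpha : R) : Prop :=
  [/\ r = 3%N,
      exists Om : 'I_n -> finProbSpace R,
        bases_of_finite_spaces X Om /\ least_nonzero_mass Om alpha,
      alpha <= 2^-1,
      eta = 2^-1 * alpha `^ (6^-1)
    & hypercontractive 2 3 eta Y].

Definition hypothesis_H4 X Y (r : nat) (eta : R) : Prop :=
  [/\ r = 4%N,
      eta = 3 `^ (- 2^-1),
      two_variable_ensembles bit_gaussian_or_uniform X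
    & two_variable_ensembles bit_gaussian_or_uniform Y].

End Hypotheses.

Definition Cr_function (R : realType) (r : nat) (Psi : R -> R) : Prop :=
  (forall k, (k < r)%N -> forall x, derivable (Psi^`(k))%classic x 1) /\
  (forall k, (k <= r)%N -> continuous (Psi^`(k))%classic).

(* The distance lives in \bar R, where oo - oo is infinite in absolute value:
   an upper bound by a real forces both expectations to be finite. *)
Definition expectation_gap (R : realType) (dX dY : measure_display)
    (TX : measurableType dX) (TY : measurableType dY)
    (PX : probability TX R) (PY : probability TY R)
    (U : TX -> R) (V : TY -> R) : \bar R :=
  (`| 'E_PX[U] - 'E_PY[V] |)%E.

(* Main.v *)
(* Put X and Y on the product of their two spaces and replace the ensembles one at a time.
   Conditionally on the other coordinates, Q is a + u with u linear in the variables of the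
   replaced ensemble.  Taylor's formula at a expresses E Psi(a + u) through the moments of u of
   order less than r, which agree, up to an error (B/r!) E|u|^r.  Averaging over the other
   coordinates, u becomes the part of Q that involves coordinate i; hypercontractivity of the
   hybrid sequence bounds its r-th moment by eta^(-rd) Inf_i(Q)^(r/2), and
   sum_i Inf_i(Q) <= d Var(Q) gives the bound under H1.

   Hypercontractivity passes from single coordinates to independent families (hence also to
   hybrids) because E (sum_b f_b^2)^(r/2) <= (sum_b |f_b|_r^2)^(r/2).  Under H2, H3 and H4 it
   therefore suffices to treat one coordinate, that is a + eta V with E V = 0: one uses
   |a + v|^3 <= |a|^3 + 3 |a| a v + 3 |a| v^2 + |v|^3 when r = 3, and the expansion of the fourth
   power together with E V^3 = 0 and E V^4 <= 9 (E V^2)^2 when r = 4. *)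

Require Import Defs.
From HB Require Import structures.
From mathcomp Require Import all_boot all_order all_algebra.
From mathcomp Require Import ring lra.
From mathcomp Require Import all_classical all_reals all_analysis.
From mathcomp Require Import measurable_realfun.

Set Implicit Arguments.
Unset Strict Implicit.
Unset Printing Implicit Defensive.

Import Order.TTheory GRing.Theory Num.Theory.
Import numFieldNormedType.Exports.

Local Open Scope classical_set_scope.
Local Open Scope ring_scope.

(** * Splitting the variables into two blocks *)

Section MergePolynomials.
Context {R : realType} {n : nat} {m : 'I_n -> nat}.
Implicit Types (Q : mlpoly R m) (S : {set 'I_n}) (a b s : multi_index m).
Implicit Types (x y : forall i, 'I_(m i).+1 -> R).

(** The moment bound compares with the coefficient norm [ml_norm2], not with an L2 norm of Q. In
    this form it makes sense for a hybrid that is not known to be orthonormal, and it tensorizes by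
    splitting coefficients. Orthonormality enters only at single coordinates: for r = 2 and eta = 1
    the one-coordinate bound is Parseval's identity, and tensorizing it puts the assumed
    hypercontractivity into this form.

    Conditioning on the other coordinates must be extracted from independence, which is given as a
    product formula for events. Two copies of the sample space carry the two coarse sigma-algebras;
    the diagonal map has a product law there, and Fubini's theorem stands in for conditional
    expectation.

    The power eta^(-rd) arises by writing the part of Q as the noise operator applied to its formal
    inverse, which enlarges a coefficient by a factor of at most eta^(-d). Under H2, H3 and H4 the
    factor d is absorbed by enlarging the base of the exponential: 16 sqrt(2), 8 and 9 become 30, 10
    and 10. *)

Definition mi_supp s : {set 'I_n} := [set i | s i != ord0].

Lemma mi_ext a b : (forall i, a i = b i) -> a = b.
Proof. by move=> h; apply/(@ffunP _ _ a b). Qed.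

Lemma mi_sizeE s : mi_size s = #|mi_supp s|.
Proof. by rewrite /mi_size; apply: eq_card => i; rewrite !inE. Qed.

Definition ml_eval Q x : R := \sum_s Q s * \prod_(i < n) x i (s i).

Definition ml_norm2 Q : R := \sum_s Q s ^+ 2.

Definition ml_supported S Q := forall s, Q s != 0 -> mi_supp s \subset S.

Definition mi_merge S a b : multi_index m :=
  [ffun i => if i \in S then a i else b i].

Definition pt_merge S x y : forall i, 'I_(m i).+1 -> R :=
  fun i => if i \in S then x i else y i.
Arguments pt_merge : clear implicits.

(* [ml_part S Q b] is the coefficient, a polynomial in the variables of [S],
   of the monomial [b] in the variables outside [S]. *)
Definition ml_part S Q b : mlpoly R m :=
  [ffun a => if (mi_supp a \subset S) && (mi_supp b \subset ~: S)
             then Q (mi_merge S a b) else 0].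

Definition mi_zero : multi_index m := [ffun i => ord0].

Lemma mi_suppP S s : reflect (forall i, i \notin S -> s i = ord0) (mi_supp s \subset S).
Proof.
apply: (iffP fintype.subsetP) => h i.
  by apply: contraNeq => si; apply: h; rewrite inE.
by rewrite inE; apply: contraNT => /h ->; rewrite eqxx.
Qed.

Lemma mi_supp_merge S a b : mi_supp a \subset S -> mi_supp b \subset ~: S ->
  mi_supp (mi_merge S a b) = mi_supp a :|: mi_supp b.
Proof.
move=> /mi_suppP ha /mi_suppP hb; apply/setP => i; rewrite !inE ffunE.
case: ifPn => iS; last by rewrite ha.
by rewrite (hb i) ?inE ?iS// eqxx orbF.
Qed.

Lemma mi_size_merge S a b : mi_supp a \subset S -> mi_supp b \subset ~: S ->
  mi_size (mi_merge S a b) = (mi_size a + mi_size b)%N.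
Proof.
move=> ha hb; rewrite !mi_sizeE mi_supp_merge// cardsU.
suff -> : mi_supp a :&: mi_supp b = finset.set0 by rewrite cards0 subn0.
apply/eqP; rewrite -finset.subset0; apply: (fintype.subset_trans (finset.setISS ha hb)).
by rewrite finset.setICr.
Qed.

(** Reindexing along the bijection between multi-indices and pairs of multi-indices living outside
    and inside [S]. *)
Lemma sum_mi_merge (V : nmodType) S (F : multi_index m -> V) :
  \sum_s F s = \sum_(b | mi_supp b \subset ~: S) \sum_(a | mi_supp a \subset S)
                F (mi_merge S a b).
Proof.
rewrite pair_big (reindex_onto (fun p => mi_merge S p.2 p.1)
  (fun s => (mi_merge S mi_zero s, mi_merge S s mi_zero))); last first.
  by move=> s _ /=; apply: mi_ext => i; rewrite !ffunE; case: (i \in S).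
apply: eq_big => [[b a]/=|//]; apply/idP/andP.
  move=> /eqP e; have /= hb := congr1 fst e; have /= ha := congr1 snd e.
  split; apply/mi_suppP => i iS; [rewrite -hb|rewrite -ha]; rewrite !ffunE ?(negPf iS)//.
  by move: iS; rewrite inE => /negbNE ->.
move=> [/mi_suppP hb /mi_suppP ha]; apply/eqP; congr pair;
    apply: mi_ext => i; rewrite !ffunE; have [iS|iS] := boolP (i \in S) => //.
  by rewrite hb// inE iS.
by rewrite ha.
Qed.

Lemma prod_mi_merge S a b x y :
  (forall i, x i ord0 = 1) -> (forall i, y i ord0 = 1) ->
  mi_supp a \subset S -> mi_supp b \subset ~: S ->
  \prod_(i < n) pt_merge S x y i (mi_merge S a b i) =
  (\prod_(i < n) x i (a i)) * \prod_(i < n) y i (b i).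
Proof.
move=> x1 y1 /mi_suppP ha /mi_suppP hb; rewrite -big_split; apply: eq_bigr => i _ /=.
rewrite /pt_merge ffunE; case: ifPn => iS; last by rewrite ha// x1 mul1r.
by rewrite hb ?inE ?iS// y1 mulr1.
Qed.

(** The size of a multi-index is additive over the two blocks, so the noise operator acts on each
    block separately. This is what permits induction on the number of coordinates. *)
Lemma ml_eval_merge (eta : R) S Q x y :
  (forall i, x i ord0 = 1) -> (forall i, y i ord0 = 1) ->
  ml_eval (ml_noise eta Q) (pt_merge S x y) =
  ml_eval (ml_noise eta [ffun b => ml_eval (ml_noise eta (ml_part S Q b)) x]) y.
Proof.
move=> x1 y1; rewrite /ml_eval (sum_mi_merge S).
rewrite [LHS]big_mkcond; apply: eq_bigr => b _; case: ifPn => hb.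
  rewrite 2!ffunE mulr_sumr mulr_suml [LHS]big_mkcond; apply: eq_bigr => a _; rewrite !ffunE hb andbT.
  case: ifPn => ha; last by rewrite !(mulr0, mul0r).
  by rewrite prod_mi_merge// mi_size_merge// exprD; ring.
rewrite 2!ffunE big1 ?mulr0 ?mul0r// => a _.
by rewrite !ffunE (negPf hb) andbF mulr0 mul0r.
Qed.

(** Each coefficient of [Q] lands in exactly one part. In the tensorization this evaluates the sum
    of the squared weights. *)
Lemma ml_part_norm2 S Q : \sum_b ml_norm2 (ml_part S Q b) = ml_norm2 Q.
Proof.
rewrite /ml_norm2 [RHS](sum_mi_merge S) [RHS]big_mkcond; apply: eq_bigr => b _.
case: ifPn => hb; last by rewrite big1// => a _; rewrite ffunE (negPf hb) andbF expr0n.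
rewrite [RHS]big_mkcond; apply: eq_bigr => a _; rewrite ffunE hb andbT.
by case: ifP; rewrite ?expr0n.
Qed.

Lemma ml_part_supported S A Q b : ml_supported A Q -> ml_supported (A :&: S) (ml_part S Q b).
Proof.
move=> hQ a; rewrite ffunE; case: ifPn => [/andP[ha hb]|]; last by rewrite eqxx.
by move=> /hQ; rewrite mi_supp_merge// finset.subUset finset.subsetI ha andbT => /andP[].
Qed.

(** A monomial [b] that leaves [A] has zero part. The functional [f] stays abstract because
    evaluation is needed both with and without noise. *)
Lemma ml_part_supportedr S A Q (f : mlpoly R m -> R) : f 0 = 0 ->
  ml_supported A Q -> ml_supported (A :\: S) [ffun b => f (ml_part S Q b)].
Proof.
move=> f0 hQ b; rewrite ffunE => h.
have [a] : exists a, ml_part S Q b a != 0.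
  apply/existsP; apply: contra_neqT h => /existsPn h.
  suff -> : ml_part S Q b = 0 by [].
  by apply/ffunP => a; rewrite [RHS]ffunE; apply/eqP; rewrite -[_ == _]negbK h.
rewrite ffunE; case: ifPn => [/andP[ha hb]|]; last by rewrite eqxx.
move=> /hQ; rewrite mi_supp_merge// finset.subUset => /andP[_ bA].
by rewrite finset.setDE finset.subsetI bA.
Qed.

Lemma ml_eval0 x : ml_eval 0 x = 0.
Proof. by rewrite /ml_eval big1// => s _; rewrite ffunE mul0r. Qed.

Lemma ml_noise0 eta : ml_noise eta 0 = 0 :> mlpoly R m.
Proof. by apply/ffunP => s; rewrite !ffunE mulr0. Qed.

Lemma ml_noise1 Q : ml_noise 1 Q = Q.
Proof. by apply/ffunP => s; rewrite ffunE expr1n mul1r. Qed.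

Lemma ml_norm2_ge0 Q : 0 <= ml_norm2 Q.
Proof. by apply: sumr_ge0 => s _; exact: sqr_ge0. Qed.

End MergePolynomials.
Arguments pt_merge {R n m} S x y i.

(** * Independent coordinates *)

Section IndependentSigmaAlgebras.
Context {R : realType} {d : measure_display} {T : measurableType d}.
Variables (P : probability T R) (C1 C2 : set (set T)).
Hypotheses (C1m : C1 `<=` measurable) (C2m : C2 `<=` measurable).
Hypotheses (C1I : setI_closed C1) (C2I : setI_closed C2).
Hypotheses (C1T : C1 setT) (C2T : C2 setT).
Hypothesis P12 : forall A B, C1 A -> C2 B -> P (A `&` B) = (P A * P B)%E.

Local Notation S1 := (g_sigma_algebraType C1).
Local Notation S2 := (g_sigma_algebraType C2).

Lemma sub_gen_measurable (C : set (set T)) : C `<=` measurable -> <<s C >> `<=` @measurable _ T.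
Proof. by move=> Cm; apply: smallest_sub => //; exact: sigma_algebra_measurable. Qed.

Let scaleP (c : {nonneg R}) : {measure set T -> \bar R} := mscale c P.

(** Uniqueness of finite measures on a pi-system, used twice: the second event is extended to its
    generated sigma-algebra first, then the first event. *)
Lemma indep_gen A B : <<s C1 >> A -> <<s C2 >> B -> P (A `&` B) = (P A * P B)%E.
Proof.
have step (C : set (set T)) (Cm : C `<=` measurable) (CI : setI_closed C) (CT : C setT) D :
    measurable D -> (forall A, C A -> P (A `&` D) = (P A * P D)%E) ->
    forall A, <<s C >> A -> P (A `&` D) = (P A * P D)%E.
  move=> mD CD E CE.
  have PDfin : P D \is a fin_num by exact: fin_num_measure.
  pose c : {nonneg R} := NngNum (fine_ge0 (measure_ge0 P D)).
  have -> : (P E * P D = scaleP c E)%E.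
    by rewrite /scaleP /= /mscale /= fineK// muleC.
  rewrite -[LHS]/(mrestr P mD E).
  apply: (g_sigma_algebra_measure_unique C Cm (fun=> setT)) => //.
  - by rewrite bigcup_const.
  - move=> F CF; rewrite /scaleP /= /mrestr /mscale /= fineK// [RHS]muleC.
    exact: CD.
  - move=> _; rewrite /= /mrestr (le_lt_trans (probability_le1 _ _)) ?ltry//.
    by rewrite setTI.
have h1 F E : C1 F -> <<s C2 >> E -> P (F `&` E) = (P F * P E)%E.
  move=> CF CE; rewrite setIC muleC; apply: (step C2) => // [|G CG].
    exact: C1m.
  by rewrite setIC muleC P12.
move=> CA CB; apply: (step C1) => // [|F CF]; last exact: h1.
exact: sub_gen_measurable C2m _ CB.
Qed.

(** The identity, seen as a map to [T] with a coarser sigma-algebra; its law is the restriction of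
    [P]. *)
Let id1 : T -> S1 := id.
Let id2 : T -> S2 := id.
Let mid1 : measurable_fun setT id1.
Proof. by move=> _ B mB; rewrite setTI; exact: sub_gen_measurable C1m _ mB. Qed.
Let mid2 : measurable_fun setT id2.
Proof. by move=> _ B mB; rewrite setTI; exact: sub_gen_measurable C2m _ mB. Qed.

HB.instance Definition _ := isMeasurableFun.Build _ _ _ _ id1 mid1.
HB.instance Definition _ := isMeasurableFun.Build _ _ _ _ id2 mid2.

Let P1 : probability S1 R := distribution P id1.
Let P2 : probability S2 R := distribution P id2.

Let diag (t : T) : S1 * S2 := (t, t).
Let mdiag : measurable_fun setT diag.
Proof. exact: (measurable_fun_pair mid1 mid2). Qed.

HB.instance Definition _ := isMeasurableFun.Build _ _ _ _ diag mdiag.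

Let PD : probability (S1 * S2)%type R := distribution P diag.

Let prodE A : measurable A -> (P1 \x P2)%E A = PD A.
Proof.
move=> mA; apply: product_measure_unique mA => B C mB mC.
rewrite /PD /P1 /P2 /= /pushforward.
by rewrite -[LHS]/(P (B `&` C)) indep_gen.
Qed.

(* By independence the law of t |-> (t, t) is the product of its two marginals. *)
Lemma indep_fubini_ge0 (F : (S1 * S2)%type -> \bar R) : measurable_fun setT F ->
  (forall z, (0 <= F z)%E) ->
  (\int[P]_t F (t, t) = \int[P]_t \int[P]_s F (t, s))%E.
Proof.
move=> mF F0.
transitivity (\int[PD]_z F z)%E.
  by rewrite ge0_integral_distribution.
transitivity (\int[P1 \x P2]_z F z)%E.
  by apply: eq_measure_integral => A mA _; exact/esym/prodE.
rewrite fubini_tonelli1// /fubini_F ge0_integral_distribution//=.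
- apply: eq_integral => t _.
  rewrite ge0_integral_distribution//.
  exact: measurableT_comp.
- exact: measurable_fun_fubini_tonelli_F.
- by move=> t; apply: integral_ge0.
Qed.

Lemma indep_fubini (F : (S1 * S2)%type -> \bar R) : measurable_fun setT F ->
  P.-integrable setT (fun t => F (t, t)) ->
  P.-integrable setT (fun t => \int[P]_s F (t, s))%E /\
  (\int[P]_t F (t, t) = \int[P]_t \int[P]_s F (t, s))%E.
Proof.
move=> mF iF.
have iPD : PD.-integrable setT F by exact: integrable_pushforward.
have iP12 : (P1 \x P2)%E.-integrable setT F.
  apply/integrableP; split => //; have /integrableP[_] := iPD.
  rewrite (@eq_measure_integral _ _ _ _ (P1 \x P2)%E)// => A mA _; exact/esym/prodE.
(* A given slice of [F] need not be integrable, so the change of measure is made on its positive and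
   negative parts, which are nonnegative. *)
have FE t : (\int[P2]_s F (t, s) = \int[P]_s F (t, s))%E.
  have mFt : measurable_fun setT (fun s : S2 => F (t, s)) by exact: measurableT_comp.
  rewrite [LHS]integralE [RHS]integralE; congr (_ - _)%E.
    rewrite ge0_integral_distribution//=; exact: measurable_funepos.
  rewrite ge0_integral_distribution//=; exact: measurable_funeneg.
have iG : P1.-integrable setT (fun t => \int[P2]_s F (t, s))%E.
  exact: integrable_fubini_F.
have iG' : P.-integrable setT (fun t => \int[P]_s F (t, s))%E.
  have /integrableP[mG fG] := iG.
  apply/integrableP; split.
    have := measurableT_comp mG mid1.
    by apply: eq_measurable_fun => t _ /=; rewrite FE.
  move: fG; rewrite ge0_integral_distribution//=; last exact: measurableT_comp.
  by under eq_integral do rewrite FE.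
split => //.
transitivity (\int[PD]_z F z)%E; first by rewrite integral_distribution.
transitivity (\int[P1 \x P2]_z F z)%E.
  by apply: eq_measure_integral => A mA _; exact/esym/prodE.
rewrite -integral12_prod_meas1// integral_distribution//=.
- by apply: eq_integral => t _; exact: FE.
- by have /integrableP[] := iG.
- apply: eq_integrable iG' => // t _; exact/esym/FE.
Qed.

End IndependentSigmaAlgebras.

Section Freezing.
Context {R : realType} {n : nat} {m : 'I_n -> nat}.
Context {d : measure_display} {T : measurableType d}.
Variable P : probability T R.
Implicit Type x : forall i : 'I_n, 'I_(m i).+1 -> T -> R.

Definition sample x (t : T) : forall i, 'I_(m i).+1 -> R := fun i j => x i j t.
Arguments sample : clear implicits.

Definition measurable_family x := forall i j, measurable_fun setT (x i j).

(** The condition of [independent_families] for bare functions, so that it also applies to hybrids,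
    which are not packaged as random variables. *)
Definition independent_coords x :=
  forall (J : {set 'I_n}) (A : 'I_n -> set T),
    (forall i, i \in J -> g_sigma_preimage (x i) (A i)) ->
    P (\bigcap_(i in [set` J]) A i) = (\prod_(i in J) P (A i))%E.

Lemma g_sigma_preimage_measurable k (f : 'I_k -> T -> R) :
  (forall j, measurable_fun setT (f j)) -> g_sigma_preimage f `<=` measurable.
Proof.
move=> mf; apply: smallest_sub; first exact: sigma_algebra_measurable.
elim/big_ind : _ => // [A B hA hB C [/hA|/hB]//|j _ _ [B mB <-]].
by rewrite setTI -[_ @^-1` _]setTI; exact: mf.
Qed.

Lemma g_sigma_preimage_sub k (f : 'I_k -> T -> R) j (B : set R) :
  measurable B -> g_sigma_preimage f (f j @^-1` B).
Proof.
move=> mB; apply: sub_sigma_algebra; rewrite (bigD1 j)//=; left.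
by exists B => //; rewrite setTI.
Qed.

Section Coordinate.
Variables (x : forall i : 'I_n, 'I_(m i).+1 -> T -> R) (k : 'I_n).
Arguments x : clear implicits.
Hypotheses (mx : measurable_family x) (ix : independent_coords x).

(** Cylinders over the coordinates other than [k]: a pi-system, in general not a sigma-algebra, on
    which the product formula can be read off directly. *)
Let others : set (set T) :=
  [set B | exists2 A : 'I_n -> set T,
    (forall i, i != k -> g_sigma_preimage (x i) (A i)) &
    B = \bigcap_(i in [set` [set~ k]%SET]) A i].
Let this : set (set T) := g_sigma_preimage (x k).

Let this_sub : this `<=` measurable.
Proof. exact: g_sigma_preimage_measurable. Qed.

Let others_sub : others `<=` measurable.
Proof.
move=> _ [A hA ->]; apply: fin_bigcap_measurable => // i /=.
by rewrite !inE => /hA; exact: g_sigma_preimage_measurable.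
Qed.

Let thisI : setI_closed this.
Proof. by move=> A B hA hB; exact: (@measurableI _ (g_sigma_algebraType _)). Qed.

Let othersI : setI_closed others.
Proof.
move=> _ _ [A hA ->] [B hB ->]; exists (fun i => A i `&` B i).
  by move=> i ik; apply: (@measurableI _ (g_sigma_algebraType _)); [exact: hA|exact: hB].
by rewrite bigcapI.
Qed.

Let thisT : this setT.
Proof. exact: (@measurableT _ (g_sigma_algebraType _)). Qed.

Let othersT : others setT.
Proof.
exists (fun=> setT) => [i _|]; first exact: (@measurableT _ (g_sigma_algebraType _)).
by apply/seteqP; split.
Qed.

(** Independence is applied twice: to all coordinates with [B] inserted at [k], and to the
    coordinates other than [k]. *)
Let others_this A B : others A -> this B -> P (A `&` B) = (P A * P B)%E.
Proof.
move=> [F hF ->] hB.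
pose G i := if i == k then B else F i.
have FG : \bigcap_(i in [set` [set~ k]%SET]) F i = \bigcap_(i in [set` [set~ k]%SET]) G i.
  by apply: eq_bigcapr => i /=; rewrite !inE /G => /negPf ->.
have hG i : g_sigma_preimage (x i) (G i).
  by rewrite /G; case: eqVneq => [->//|/hF].
have -> : \bigcap_(i in [set` [set~ k]%SET]) F i `&` B = \bigcap_(i in [set` [set: 'I_n]%SET]) G i.
  apply/seteqP; split=> [t [ht tB] i _|t ht].
    by rewrite /G; case: eqVneq => [//|ik]; apply: ht; rewrite /= !inE.
  split; last by have := ht k; rewrite /G eqxx; apply; rewrite /= inE.
  by rewrite FG => i _; apply: ht; rewrite /= inE.
rewrite ix// FG ix// (bigD1 k) ?inE//= muleC; congr (_ * _)%E; last by rewrite /G eqxx.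
by apply: eq_bigl => i; rewrite !inE.
Qed.

(** Measurability is for the two coarse sigma-algebras: the factor at [k] reads only the second
    component, every other factor only the first. *)
Let eval_pair (Q : mlpoly R m) :
  measurable_fun setT (fun z : g_sigma_algebraType others * g_sigma_algebraType this =>
    ml_eval Q (pt_merge [set~ k]%SET (sample x z.1) (sample x z.2))).
Proof.
apply: measurable_sum => s; apply: measurable_funM => //.
apply: measurable_prod => i _; rewrite /pt_merge !inE.
have [->|ik] := eqVneq i k => /=.
  have h : measurable_fun setT (fun z : g_sigma_algebraType this => x k (s k) z).
    move=> _ B mB; rewrite setTI; apply: sub_sigma_algebra.
    exact: g_sigma_preimage_sub.
  exact: (measurableT_comp h).
have h : measurable_fun setT (fun z : g_sigma_algebraType others => x i (s i) z).
  move=> _ B mB; rewrite setTI; apply: sub_sigma_algebra.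
  (* An event of the single coordinate [i] is a cylinder whose other sides are the whole space. *)
  exists (fun l => if l == i then x i (s i) @^-1` B else setT).
    move=> l lk; case: eqVneq => [->|_]; first exact: g_sigma_preimage_sub.
    exact: (@measurableT _ (g_sigma_algebraType _)).
  apply/seteqP; split=> [t ht l _|t ht].
    by case: eqVneq.
  by have := ht i; rewrite eqxx; apply; rewrite /= !inE.
exact: (measurableT_comp h).
Qed.

Lemma sample_merge t : pt_merge [set~ k]%SET (sample x t) (sample x t) = sample x t.
Proof. by apply: functional_extensionality_dep => i; rewrite /pt_merge; case: ifP. Qed.

(** The inner integral plays the role of the conditional expectation given the coordinates other
    than [k]: these stay at [t], while coordinate [k] is resampled from [s]. *)
Lemma freeze_ge0 Q (phi : R -> \bar R) : measurable_fun setT phi -> (forall u, (0 <= phi u)%E) ->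
  (\int[P]_t phi (ml_eval Q (sample x t)) = \int[P]_t \int[P]_s
     phi (ml_eval Q (pt_merge [set~ k]%SET (sample x t) (sample x s))))%E.
Proof.
move=> mphi phi0.
rewrite -(indep_fubini_ge0 others_sub this_sub othersI thisI othersT thisT others_this
  (F := fun z => phi (ml_eval Q (pt_merge [set~ k]%SET (sample x z.1) (sample x z.2)))))//=.
  by apply: eq_integral => t _; rewrite sample_merge.
exact: (measurableT_comp mphi (eval_pair Q)).
Qed.

Lemma freeze Q (phi : R -> \bar R) : measurable_fun setT phi ->
  P.-integrable setT (fun t => phi (ml_eval Q (sample x t))) ->
  P.-integrable setT (fun t => \int[P]_s
     phi (ml_eval Q (pt_merge [set~ k]%SET (sample x t) (sample x s))))%E /\
  (\int[P]_t phi (ml_eval Q (sample x t)) = \int[P]_t \int[P]_s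
     phi (ml_eval Q (pt_merge [set~ k]%SET (sample x t) (sample x s))))%E.
Proof.
move=> mphi iphi.
have [||iF eF] := indep_fubini others_sub this_sub othersI thisI othersT thisT others_this
  (F := fun z => phi (ml_eval Q (pt_merge [set~ k]%SET (sample x z.1) (sample x z.2)))).
- exact: (measurableT_comp mphi (eval_pair Q)).
- by under eq_fun do rewrite /= sample_merge.
split => //; rewrite -eF; apply: eq_integral => t _ /=.
by rewrite sample_merge.
Qed.

End Coordinate.
End Freezing.
Arguments sample {R n m d T} x t i j.

(** * Moment bounds and their tensorization *)

(** Weighted AM-GM with weights 2 and [k], with equality at [u = v]. *)
Lemma amgm_pow (R : realFieldType) (k : nat) (u v : R) : 0 <= u -> 0 <= v ->
  k.+2%:R * (u ^+ 2 * v ^+ k) <= 2 * u ^+ k.+2 + k%:R * v ^+ k.+2.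
Proof.
move=> u0 v0; elim: k => [|k ih]; first by rewrite expr0 mul0r mulr1 addr0.
(* The gap at k+1 exceeds v times the gap at k by (u - v)(2 u^(k+2) - v^(k+1) (u + v)). *)
have key : 0 <= (u - v) * (2 * u ^+ k.+2 - v ^+ k.+1 * (u + v)).
  have [vu|uv] := leP v u.
    apply: mulr_ge0; first by rewrite subr_ge0.
    have h : v ^+ k.+1 <= u ^+ k.+1 by rewrite lerXn2r.
    have h2 : v ^+ k.+1 * (u + v) <= u ^+ k.+1 * (u + u).
      by apply: ler_pM => //; [exact: exprn_ge0|exact: addr_ge0|rewrite lerD2l].
    by rewrite subr_ge0 (le_trans h2)// [in leRHS]exprSr; lra.
  rewrite -mulrNN; apply: mulr_ge0; first by rewrite opprB subr_ge0 ltW.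
  have uv' := ltW uv; have h : u ^+ k.+1 <= v ^+ k.+1 by rewrite lerXn2r.
  have h2 : u ^+ k.+1 * (u + u) <= v ^+ k.+1 * (u + v).
    by apply: ler_pM => //; [exact: exprn_ge0|exact: addr_ge0|rewrite lerD2l].
  by rewrite opprB subr_ge0 (le_trans _ h2)// [in leLHS]exprSr; lra.
have := ler_wpM2l v0 ih; rewrite !exprS -![k.+3%:R]natr1 -![k.+2%:R]natr1 -![k.+1%:R]natr1.
move: key; rewrite !exprS; set a := u ^+ k; set b := v ^+ k; set c := k%:R.
by move=> key h; lra.
Qed.

(** This is Jensen's inequality for the power (k+2)/2 with weights proportional to [s i ^+ 2]. A
    zero weight forces [f i = 0] by hypothesis, which agrees with division by zero being zero. *)
Lemma sqrt_sum_pow_le (R : realType) (I : finType) (k : nat) (f s : I -> R) :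
  (forall i, 0 <= s i) -> (forall i, s i = 0 -> f i = 0) ->
  Num.sqrt (\sum_i f i ^+ 2) ^+ k.+2 <=
  Num.sqrt (\sum_i s i ^+ 2) ^+ k * \sum_i `|f i| ^+ k.+2 / s i ^+ k.
Proof.
move=> s0 sf; set F := Num.sqrt _; set S := Num.sqrt _.
have F0 : 0 <= F by exact: sqrtr_ge0.
have F2 : F ^+ 2 = \sum_i f i ^+ 2 by rewrite sqr_sqrtr// sumr_ge0// => i _; exact: sqr_ge0.
have S2 : S ^+ 2 = \sum_i s i ^+ 2 by rewrite sqr_sqrtr// sumr_ge0// => i _; exact: sqr_ge0.
have [S0|Sn0] := eqVneq S 0.
  have si0 i : s i = 0.
    move: S2; rewrite S0 expr0n/= => /esym/eqP; rewrite psumr_eq0 => [/allP h|j _]; last exact: sqr_ge0.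
    by have := h i; rewrite mem_index_enum /= sqrf_eq0 => /(_ isT)/eqP.
  have -> : F = 0 by rewrite /F big1 ?sqrtr0// => i _; rewrite sf// expr0n.
  rewrite expr0n mulr_ge0 ?exprn_ge0 ?sqrtr_ge0// sumr_ge0// => i _.
  by rewrite divr_ge0 ?exprn_ge0.
have Sp : 0 < S by rewrite lt_neqAle eq_sym Sn0 sqrtr_ge0.
(* AM-GM with u = |f i| / s i and v = F / S, weighted by (s i)^2 and summed over i. *)
have term i : k.+2%:R * (f i ^+ 2 * (F ^+ k / S ^+ k)) <=
    2 * (`|f i| ^+ k.+2 / s i ^+ k) + k%:R * (F ^+ k.+2 / S ^+ k.+2) * s i ^+ 2.
  have [si0|sin0] := eqVneq (s i) 0.
    rewrite (sf _ si0) si0 normr0 !expr0n/= !mul0r !mulr0.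
    by rewrite addr0.
  have sip : 0 < s i by rewrite lt_neqAle eq_sym sin0 s0.
  have := @amgm_pow R k (`|f i| / s i) (F / S).
  rewrite !divr_ge0 ?(ltW Sp)// => /(_ isT isT); rewrite !expr_div_n.
  (* The weight [s i ^+ 2] lowers the denominator to [s i ^+ k] and makes the last terms sum to a
     multiple of [S ^+ 2]. *)
  move/(ler_wpM2r (sqr_ge0 (s i))); rewrite real_normK ?num_real//.
  rewrite (_ : s i ^+ k.+2 = s i ^+ k * s i ^+ 2); last by rewrite -exprD addn2.
  have a0 : s i ^+ k != 0 by rewrite expf_neq0.
  move: (s i ^+ k) a0 (F ^+ k / S ^+ k) (F ^+ k.+2 / S ^+ k.+2) (`|f i| ^+ k.+2) => a a0 p q g h.
  have -> : k.+2%:R * (f i ^+ 2 * p) = k.+2%:R * (f i ^+ 2 / s i ^+ 2 * p) * s i ^+ 2 by field.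
  have -> : 2 * (g / a) + k%:R * q * s i ^+ 2 = (2 * (g / (a * s i ^+ 2)) + k%:R * q) * s i ^+ 2.
    by field; rewrite sin0.
  exact: h.
have E : F ^+ k.+2 / S ^+ k.+2 * S ^+ 2 = F ^+ k.+2 / S ^+ k.
  rewrite (_ : S ^+ k.+2 = S ^+ k * S ^+ 2); last by rewrite -exprD addn2.
  by field; rewrite Sn0 expf_neq0.
(* After summation, [k] copies of F^(k+2) / S^k cancel between the two sides, which leaves twice the
   claim. *)
have := ler_sum (index_enum I) (fun i (_ : xpredT i) => term i).
rewrite -mulr_sumr -mulr_suml -F2 big_split /= -!mulr_sumr -S2.
rewrite -[k%:R * _ * _]mulrA E [F ^+ 2 * _]mulrA -exprD add2n -natr1 -[k.+1%:R]natr1 => h.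
by rewrite mulrC -ler_pdivrMr ?exprn_gt0//; lra.
Qed.

Lemma measurable_fun_sqrt {R : realType} {d} {T : measurableType d} (f : T -> R) :
  measurable_fun setT f -> measurable_fun setT (fun t => Num.sqrt (f t)).
Proof.
move=> mf; have h : measurable_fun setT (Num.sqrt : R -> R).
  by apply: continuous_measurable_fun; exact: sqrt_continuous.
exact: (measurableT_comp h mf).
Qed.

Section MomentBounds.
Context {R : realType} {n : nat} {m : 'I_n -> nat}.

(* For orthonormal coordinates the right-hand side is a power of the L2 norm of Q: this is
   (2,r,eta)-hypercontractivity for the polynomials in the variables of S. *)
Definition moment_bound {d} {T : measurableType d} (P : probability T R)
    (x : forall i : 'I_n, 'I_(m i).+1 -> T -> R) (r : nat) (eta : R) (S : {set 'I_n}) :=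
  forall Q : mlpoly R m, ml_supported S Q ->
  (\int[P]_t (`|ml_eval (ml_noise eta Q) (sample x t)| ^+ r)%:E
     <= (Num.sqrt (ml_norm2 Q) ^+ r)%:E)%E.

Lemma measurable_ml_eval {d} {T : measurableType d} (z : T -> forall i, 'I_(m i).+1 -> R) Q :
  (forall i j, measurable_fun setT (fun t => z t i j)) ->
  measurable_fun setT (fun t => ml_eval Q (z t)).
Proof.
move=> mz; apply: measurable_sum => s; apply: measurable_funM => //.
by apply: measurable_prod => i _.
Qed.

(** The triangle inequality in L^(r/2) for the squares of the [f i]. The pointwise bound is linear
    in the powers |f_i|^r, so the moment hypotheses enter term by term. *)
Lemma integral_sqrt_sum_pow {d} {T : measurableType d} (P : probability T R)
    (I : finType) (r : nat) (f : I -> T -> R) (s : I -> R) : (2 <= r)%N ->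
  (forall i, measurable_fun setT (f i)) ->
  (forall i, 0 <= s i) -> (forall i, s i = 0 -> forall t, f i t = 0) ->
  (forall i, (\int[P]_t (`|f i t| ^+ r)%:E <= (s i ^+ r)%:E)%E) ->
  (\int[P]_t (Num.sqrt (\sum_i f i t ^+ 2) ^+ r)%:E
     <= (Num.sqrt (\sum_i s i ^+ 2) ^+ r)%:E)%E.
Proof.
case: r => [|[|k]]// _ mf s0 sf hf.
set S := Num.sqrt (\sum_i s i ^+ 2).
have S2 : S ^+ 2 = \sum_i s i ^+ 2 by rewrite sqr_sqrtr// sumr_ge0// => i _; exact: sqr_ge0.
have S0 : 0 <= S by exact: sqrtr_ge0.
have mp i : measurable_fun setT (fun t => (`|f i t| ^+ k.+2)%:E).
  by apply/measurable_EFinP; apply: measurable_funX; exact: measurableT_comp.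
apply: (@le_trans _ _ (\int[P]_t \sum_i (S ^+ k / s i ^+ k)%:E * (`|f i t| ^+ k.+2)%:E))%E.
  apply: ge0_le_integral => //.
  - apply/measurable_EFinP; apply: measurable_funX.
    apply: measurable_fun_sqrt.
    by apply: measurable_sum => i; apply: measurable_funX.
  - by apply: emeasurable_sum => i; apply: measurable_funeM.
  - move=> t _; under [X in (_ <= X)%E]eq_bigr do rewrite -EFinM.
    rewrite sumEFin lee_fin (le_trans (sqrt_sum_pow_le k s0 (fun i si => sf i si t)))//.
    by rewrite mulr_sumr ler_sum// => i _; rewrite mulrCA mulrC mulrA.
rewrite ge0_integral_sum//; last 2 first.
  - by move=> i; apply: measurable_funeM.
  - by move=> i t _; rewrite mule_ge0// lee_fin ?divr_ge0 ?exprn_ge0.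
apply: (@le_trans _ _ (\sum_i (S ^+ k * s i ^+ 2)%:E)%E); last first.
  by rewrite sumEFin lee_fin -mulr_sumr -S2 -exprD addn2.
apply: lee_sum => i _; rewrite ge0_integralZl//; last by rewrite lee_fin divr_ge0 ?exprn_ge0.
have [si0|sin0] := eqVneq (s i) 0.
  rewrite integral0_eq ?mule0 ?lee_fin ?mulr_ge0 ?exprn_ge0 ?sqr_ge0// => t _.
  by rewrite (sf _ si0) normr0 expr0n.
apply: (le_trans (lee_wpmul2l _ (hf i))); first by rewrite lee_fin divr_ge0 ?exprn_ge0.
by rewrite -EFinM lee_fin -(addn2 k) exprD mulrA divfK ?expf_neq0.
Qed.

Lemma ml_norm2_eq0 (Q : mlpoly R m) : ml_norm2 Q = 0 -> Q = 0.
Proof.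
move=> /eqP; rewrite psumr_eq0 => [/allP h|s _]; last exact: sqr_ge0.
apply/ffunP => s; rewrite [RHS]ffunE; have := h s.
by rewrite mem_index_enum /= sqrf_eq0 => /(_ isT)/eqP.
Qed.

Section Merge.
Context {d1 d2 : measure_display} {T1 : measurableType d1} {T2 : measurableType d2}.
Variables (P1 : probability T1 R) (P2 : probability T2 R).
Variables (x : forall i : 'I_n, 'I_(m i).+1 -> T1 -> R).
Variables (y : forall i : 'I_n, 'I_(m i).+1 -> T2 -> R).
Arguments x : clear implicits.
Arguments y : clear implicits.
Hypotheses (mx : measurable_family x) (my : measurable_family y).
Hypotheses (x1 : forall i t, x i ord0 t = 1) (y1 : forall i t, y i ord0 t = 1).

Lemma measurable_pt_merge M Q : measurable_fun setT (fun z : T1 * T2 =>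
  ml_eval Q (pt_merge M (sample x z.1) (sample y z.2))).
Proof.
apply: measurable_ml_eval => i j; rewrite /pt_merge; case: (i \in M).
  exact: (measurableT_comp (mx j)).
exact: (measurableT_comp (my j)).
Qed.

(** For fixed [t] the bound for [y] applies to the polynomial with coefficients [f b t]. What
    remains is the r-th moment of a square root of a sum of squares, where the bound for [x]
    controls each [f b]. Allowing two spaces serves both the tensorization and the hybrids. *)
Lemma moment_bound_merge r eta M A Q : (2 <= r)%N ->
  moment_bound P1 x r eta (A :&: M) -> moment_bound P2 y r eta (A :\: M) ->
  ml_supported A Q ->
  (\int[P1]_t \int[P2]_s
     (`|ml_eval (ml_noise eta Q) (pt_merge M (sample x t) (sample y s))| ^+ r)%:E
     <= (Num.sqrt (ml_norm2 Q) ^+ r)%:E)%E.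
Proof.
move=> r2 hx hy QA.
pose f b t := ml_eval (ml_noise eta (ml_part M Q b)) (sample x t).
have mf b : measurable_fun setT (f b) by exact: measurable_ml_eval.
apply: (@le_trans _ _ (\int[P1]_t (Num.sqrt (\sum_b f b t ^+ 2) ^+ r)%:E))%E.
  apply: ge0_le_integral => //.
  - by move=> t _; apply: integral_ge0 => s _; rewrite lee_fin exprn_ge0.
  - apply: (@measurable_fun_fubini_tonelli_F _ _ _ _ _ P2 (fun z : T1 * T2 =>
     (`|ml_eval (ml_noise eta Q) (pt_merge M (sample x z.1) (sample y z.2))| ^+ r)%:E)) => //.
      apply/measurable_EFinP; apply: measurable_funX; apply: measurableT_comp => //.
      exact: measurable_pt_merge.
  - apply/measurable_EFinP; apply: measurable_funX.
    apply: measurable_fun_sqrt.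
    by apply: measurable_sum => i; apply: measurable_funX.
  - move=> t _.
    have E s := @ml_eval_merge _ _ _ eta M Q (sample x t) (sample y s) (fun i => x1 i t) (fun i => y1 i s).
    under eq_integral do rewrite E.
    rewrite (_ : \sum_b f b t ^+ 2 = ml_norm2 [ffun b => f b t]); last first.
      by apply: eq_bigr => b _; rewrite ffunE.
    apply: hy; apply: (@ml_part_supportedr _ _ _ _ _ _ (fun q => ml_eval (ml_noise eta q) (sample x t))) => //.
    by rewrite ml_noise0 ml_eval0.
rewrite -(ml_part_norm2 M Q).
have -> : \sum_b ml_norm2 (ml_part M Q b) = \sum_b Num.sqrt (ml_norm2 (ml_part M Q b)) ^+ 2.
  by apply: eq_bigr => b _; rewrite sqr_sqrtr// ml_norm2_ge0.
apply: integral_sqrt_sum_pow => // [b h t|b].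
  have h0 : ml_norm2 (ml_part M Q b) = 0.
    by apply/eqP; rewrite eq_le ml_norm2_ge0 -sqrtr_eq0 h eqxx.
  by rewrite /f (ml_norm2_eq0 h0) ml_noise0 ml_eval0.
by apply: hx; exact: ml_part_supported.
Qed.

End Merge.

Section Tensor.
Context {d : measure_display} {T : measurableType d} (P : probability T R).
Variable (x : forall i : 'I_n, 'I_(m i).+1 -> T -> R).
Arguments x : clear implicits.
Hypotheses (mx : measurable_family x) (ix : independent_coords P x).
Hypothesis (x1 : forall i t, x i ord0 t = 1).

Lemma moment_bound_tensor r eta : (2 <= r)%N ->
  (forall k, moment_bound P x r eta [set k]%SET) -> moment_bound P x r eta [set: 'I_n]%SET.
Proof.
move=> r2 h1.
suff h S : moment_bound P x r eta S by exact: h.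
have [N] := ubnP #|S|; elim: N S => // N ih S; rewrite ltnS => SN Q QS.
have [S0|[k kS]] := set_0Vmem S.
  (* With no coordinate available, [Q] is its constant term. *)
  rewrite S0 in QS.
  have Q0 s : s != mi_zero -> Q s = 0.
    apply: contra_neqP => /eqP /QS /mi_suppP h; apply: mi_ext => i.
    by rewrite h ?inE// ffunE.
  have E t : ml_eval (ml_noise eta Q) (sample x t) = Q mi_zero.
    rewrite /ml_eval (bigD1 mi_zero)//= [X in _ + X]big1 ?addr0 => [|s s0]; last first.
      by rewrite ffunE Q0// mulr0 mul0r.
    rewrite ffunE mi_sizeE (_ : mi_supp mi_zero = finset.set0) ?cards0 ?mul1r; last first.
      by apply/setP => i; rewrite !inE ffunE eqxx.
    by rewrite big1 ?mulr1// => i _; rewrite ffunE /sample x1.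
  under eq_integral do rewrite E.
  rewrite integral_cst//= probability_setT mule1 lee_fin lerXn2r ?nnegrE ?sqrtr_ge0//.
  rewrite -sqrtr_sqr ler_wsqrtr// /ml_norm2 (bigD1 mi_zero)//= lerDl.
  by apply: sumr_ge0 => s _; exact: sqr_ge0.
(* Once coordinate [k] is resampled independently, [x] can play both families in the merge:
   induction covers [S] without [k], and the hypothesis covers [k]. *)
rewrite (@freeze_ge0 _ _ _ _ _ P x k mx ix _ (fun u => (`|u| ^+ r)%:E)).
- apply: (@moment_bound_merge _ _ _ _ P P x x mx mx x1 x1 r eta _ S) => //.
    apply: ih; rewrite (leq_trans _ SN)//; apply: proper_card.
    by rewrite -finset.setDE properD1.
  rewrite (_ : S :\: [set~ k]%SET = [set k]%SET); first exact: h1.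
  by apply/setP => i; rewrite !inE negbK; case: (i =P k) => [->|//]; rewrite kS.
- by apply/measurable_EFinP; apply: measurable_funX; exact: normr_measurable.
- by move=> u; rewrite lee_fin exprn_ge0.
Qed.

End Tensor.
End MomentBounds.

(** * Hybrid families *)

Section ProductSpace.
Context {R : realType} {n : nat} {m : 'I_n -> nat}.
Context {d1 d2 : measure_display} {T1 : measurableType d1} {T2 : measurableType d2}.
Variables (P1 : probability T1 R) (P2 : probability T2 R).

Definition prod_prob : probability (T1 * T2)%type R := (P1 \x P2)%E.

Lemma prod_probE A B : measurable A -> measurable B ->
  prod_prob (A `*` B) = (P1 A * P2 B)%E.
Proof. exact: product_measure1E. Qed.

Lemma prod_prob_fst A : measurable A -> prod_prob (fst @^-1` A) = P1 A.
Proof.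
move=> mA; have -> : fst @^-1` A = A `*` [set: T2] by apply/seteqP; split=> [z|z []].
by rewrite prod_probE// probability_setT mule1.
Qed.

Lemma prod_prob_snd A : measurable A -> prod_prob (snd @^-1` A) = P2 A.
Proof.
move=> mA; have -> : snd @^-1` A = [set: T1] `*` A by apply/seteqP; split=> [z|z []].
by rewrite prod_probE// probability_setT mul1e.
Qed.

Lemma integral_prod_fst (f : T1 -> \bar R) : measurable_fun setT f ->
  (\int[prod_prob]_z f z.1 = \int[P1]_t f t)%E.
Proof.
move=> mf.
have h (g : T1 -> \bar R) : measurable_fun setT g -> (forall t, (0 <= g t)%E) ->
    (\int[prod_prob]_z g z.1 = \int[P1]_t g t)%E.
  move=> mg g0; rewrite -(@ge0_integral_pushforward _ _ _ _ _ _ measurable_fst prod_prob setT g)//.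
  by apply: eq_measure_integral => A mA _; exact: prod_prob_fst.
rewrite integralE [RHS]integralE.
rewrite [X in (\int[_]_z X z - _)%E](funepos_comp f fst) [X in (_ - \int[_]_z X z)%E](funeneg_comp f fst).
congr (_ - _)%E.
  exact: (h _ (measurable_funepos mf) (funepos_ge0 f)).
exact: (h _ (measurable_funeneg mf) (funeneg_ge0 f)).
Qed.

Lemma integral_prod_snd (f : T2 -> \bar R) : measurable_fun setT f ->
  (\int[prod_prob]_z f z.2 = \int[P2]_t f t)%E.
Proof.
move=> mf.
have h (g : T2 -> \bar R) : measurable_fun setT g -> (forall t, (0 <= g t)%E) ->
    (\int[prod_prob]_z g z.2 = \int[P2]_t g t)%E.
  move=> mg g0; rewrite -(@ge0_integral_pushforward _ _ _ _ _ _ measurable_snd prod_prob setT g)//.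
  by apply: eq_measure_integral => A mA _; exact: prod_prob_snd.
rewrite integralE [RHS]integralE.
rewrite [X in (\int[_]_z X z - _)%E](funepos_comp f snd) [X in (_ - \int[_]_z X z)%E](funeneg_comp f snd).
congr (_ - _)%E.
  exact: (h _ (measurable_funepos mf) (funepos_ge0 f)).
exact: (h _ (measurable_funeneg mf) (funeneg_ge0 f)).
Qed.

Variables (x : forall i : 'I_n, 'I_(m i).+1 -> T1 -> R).
Variables (y : forall i : 'I_n, 'I_(m i).+1 -> T2 -> R).
Arguments x : clear implicits.
Arguments y : clear implicits.

(** The extreme cases, [M] full and [M] empty, are [x] and [y] themselves, pulled back to the
    product space. *)
Definition hybrid (M : {set 'I_n}) : forall i : 'I_n, 'I_(m i).+1 -> T1 * T2 -> R :=
  fun i j z => pt_merge M (sample x z.1) (sample y z.2) i j.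
Arguments hybrid : clear implicits.

Hypotheses (mx : measurable_family x) (my : measurable_family y).

Lemma measurable_hybrid M : measurable_family (hybrid M).
Proof.
move=> i j; rewrite /hybrid /pt_merge; case: (i \in M).
  exact: (measurableT_comp (mx j)).
exact: (measurableT_comp (my j)).
Qed.

Lemma hybrid_in (M : {set 'I_n}) i : i \in M -> hybrid M i = (fun j z => x i j z.1).
Proof. by move=> iM; rewrite /hybrid /pt_merge iM. Qed.

Lemma hybrid_notin (M : {set 'I_n}) i : i \notin M -> hybrid M i = (fun j z => y i j z.2).
Proof. by move=> /negPf iM; rewrite /hybrid /pt_merge iM. Qed.

(** Each event of a hybrid coordinate is pulled back from one factor, so an intersection of such
    events is a rectangle. *)
Lemma independent_hybrid M : independent_coords P1 x -> independent_coords P2 y ->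
  independent_coords prod_prob (hybrid M).
Proof.
move=> ix iy J A hA.
(* Only the component belonging to the factor of [i] carries information; the other one is a dummy
   [set0]. *)
have /choice[BC hBC] : forall i, exists BC : set T1 * set T2, i \in J ->
    if i \in M then g_sigma_preimage (x i) BC.1 /\ A i = fst @^-1` BC.1
    else g_sigma_preimage (y i) BC.2 /\ A i = snd @^-1` BC.2.
  move=> i; have [iJ|iJ] := boolP (i \in J); last by exists (set0, set0).
  have := hA i iJ; have [iM|iM] := boolP (i \in M).
    rewrite hybrid_in// (g_sigma_preimage_comp (fun j => x i j) fst) => -[B hB <-].
    by exists (B, set0) => _; rewrite setTI.
  rewrite hybrid_notin// (g_sigma_preimage_comp (fun j => y i j) snd) => -[B hB <-].
  by exists (set0, B) => _; rewrite setTI.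
have hB i : i \in (J :&: M)%SET -> g_sigma_preimage (x i) (BC i).1 /\ A i = fst @^-1` (BC i).1.
  by rewrite inE => /andP[/hBC + iM]; rewrite iM.
have hC i : i \in (J :\: M)%SET -> g_sigma_preimage (y i) (BC i).2 /\ A i = snd @^-1` (BC i).2.
  by rewrite inE => /andP[/negPf iM /hBC]; rewrite iM.
have mB i : i \in (J :&: M)%SET -> measurable (BC i).1.
  by move=> /hB[h _]; apply: g_sigma_preimage_measurable h => j; exact: mx.
have mC i : i \in (J :\: M)%SET -> measurable (BC i).2.
  by move=> /hC[h _]; apply: g_sigma_preimage_measurable h => j; exact: my.
have -> : \bigcap_(i in [set` J]) A i =
    (\bigcap_(i in [set` (J :&: M)%SET]) (BC i).1) `*` (\bigcap_(i in [set` (J :\: M)%SET]) (BC i).2).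
  apply/seteqP; split=> [z hz|z [/= z1 z2] i iJ].
    split=> i /= iJM.
      have := hz i; rewrite (hB i iJM).2; apply.
      by move: iJM => /=; rewrite inE => /andP[].
    have := hz i; rewrite (hC i iJM).2; apply.
    by move: iJM => /=; rewrite inE => /andP[].
  have [iM|iM] := boolP (i \in M).
    have iJM : i \in (J :&: M)%SET by rewrite inE iM andbT.
    by rewrite (hB i iJM).2; exact: z1.
  have iJM : i \in (J :\: M)%SET by rewrite inE iM.
  by rewrite (hC i iJM).2; exact: z2.
rewrite prod_probE; last 2 first.
- by apply: fin_bigcap_measurable.
- by apply: fin_bigcap_measurable.
rewrite ix ?iy; last 2 first.
- by move=> i /hC[].
- by move=> i /hB[].
rewrite [RHS](big_setID M)/=; congr (_ * _)%E; apply: eq_bigr => i iJM.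
  by rewrite (hB i iJM).2 prod_prob_fst//; exact: mB.
by rewrite (hC i iJM).2 prod_prob_snd//; exact: mC.
Qed.

Lemma moment_bound_sub {d : measure_display} {T : measurableType d} (P : probability T R)
    (z : forall i : 'I_n, 'I_(m i).+1 -> T -> R) r eta (S S' : {set 'I_n}) :
  S \subset S' -> moment_bound P z r eta S' -> moment_bound P z r eta S.
Proof. by move=> SS' h Q QS; apply: h => s /QS /fintype.subset_trans; apply. Qed.

Lemma moment_bound_hybrid M r eta : (2 <= r)%N ->
  (forall i t, x i ord0 t = 1) -> (forall i t, y i ord0 t = 1) ->
  moment_bound P1 x r eta [set: 'I_n]%SET -> moment_bound P2 y r eta [set: 'I_n]%SET ->
  moment_bound prod_prob (hybrid M) r eta [set: 'I_n]%SET.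
Proof.
move=> r2 x1 y1 hx hy Q QS.
have sub (S : {set 'I_n}) : S \subset [set: 'I_n]%SET := finset.subsetT S.
apply: (le_trans _ (moment_bound_merge mx my x1 y1 r2
  (moment_bound_sub (sub (_ :&: M)) hx) (moment_bound_sub (sub (_ :\: M)) hy) QS)).
rewrite [leRHS](_ : _ = \int[P1]_t fubini_F P2
   (fun z => (`|ml_eval (ml_noise eta Q) (sample (hybrid M) z)| ^+ r)%:E) t)%E//.
rewrite -fubini_tonelli1//.
  apply/measurable_EFinP; apply: measurable_funX; apply: measurableT_comp => //.
  by apply: measurable_ml_eval => i j; exact: measurable_hybrid.
Qed.

End ProductSpace.
Arguments hybrid {R n m d1 d2 T1 T2} x y M i j z.

(** * Taylor expansion *)

Section Taylor.
Context {R : realType}.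
Implicit Types (f g : R -> R).

(** With [p] the antiderivative of c v^r, both p - f and p + f have nonnegative derivative for v >=
    0 and vanish at 0; the sign is the parameter [s] below. *)
Lemma abs_le_of_derivative (f df : R -> R) (c : R) (r : nat) :
  (forall v : R, is_derive v 1 f (df v)) -> f 0 = 0 ->
  (forall v : R, 0 <= v -> `|df v| <= c * v ^+ r) ->
  forall v : R, 0 <= v -> `|f v| <= c * v ^+ r.+1 / r.+1%:R.
Proof.
move=> fdf f0 dfc v v0.
pose p : {poly R} := (c / r.+1%:R) *: ('X ^+ r.+1).
have dp (w : R) : is_derive w 1 (horner p) (c * w ^+ r).
  have := is_derive_poly p w; rewrite /p derivZ derivXn hornerZ hornerMn hornerXn /=.
  move=> h; rewrite (_ : c * w ^+ r = c / r.+1%:R * (w ^+ r *+ r.+1))//.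
  by rewrite -[w ^+ r *+ _]mulr_natr mulrCA divfK ?pnatr_eq0// mulrC.
have pv : p.[v] = c * v ^+ r.+1 / r.+1%:R by rewrite hornerZ hornerXn mulrAC.
have p0 : p.[0] = 0 by rewrite hornerZ hornerXn expr0n mulr0.
have main (s : R) : `|s| = 1 -> s * f v <= p.[v].
  move=> s1.
  have dg (w : R) : is_derive w 1 (horner p - (fun u => s * f u)) (c * w ^+ r - s * df w).
    by apply: is_deriveB; apply: is_deriveZ.
  have [|c0] := MVT_segment v0 (fun w _ => dg w).
    apply: derivable_within_continuous => w _; exact: ex_derive.
  rewrite in_itv /= => /andP[c0_ge0 _]; rewrite !fctE p0 f0 mulr0 !subr0 => h.
  rewrite -subr_ge0 h mulr_ge0// subr_ge0 (le_trans (ler_norm _))//.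
  by rewrite normrM s1 mul1r dfc.
rewrite -pv ler_norml; apply/andP; split.
  by rewrite lerNl -mulN1r main// normrN1.
by rewrite -[leLHS]mul1r main// normr1.
Qed.

Definition taylor_poly (r : nat) f (a : R) : {poly R} :=
  \poly_(k < r) ((f^`(k))%classic a / k`!%:R).

(** The polynomial is in the increment from [a], so differentiating it yields the Taylor polynomial
    of the derivative at the same point. *)
Lemma deriv_taylor_poly r f a : (taylor_poly r.+1 f a)^`() = taylor_poly r (f^`())%classic a.
Proof.
apply/polyP => i; rewrite coef_deriv !coef_poly ltnS; case: ifP => _; last by rewrite mul0rn.
have i0 : i.+1%:R != 0 :> R by rewrite pnatr_eq0.
by rewrite -[LHS]mulr_natr derive1Sn factS natrM [_%:R * _]mulrC invfM mulrA divfK.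
Qed.

(** Induction on [r]: the derivative of the remainder of [f] is the remainder of f', one order
    lower. No integral form of the remainder is involved. *)
Lemma taylor_bound (r : nat) f (B : R) :
  (forall k, (k < r)%N -> forall x, derivable (f^`(k))%classic x 1) ->
  (forall x, `|(f^`(r))%classic x| <= B) ->
  forall a u, `|f (a + u) - (taylor_poly r f a).[u]| <= B * `|u| ^+ r / r`!%:R.
Proof.
elim: r f => [|r ih] f fd fB a u.
  by rewrite /taylor_poly horner_poly big_ord0 subr0 expr0 mulr1 divr1; exact: fB.
have fd1 (w : R) : is_derive w 1 f ((f^`())%classic w).
  by rewrite derive1E; apply: derivableP; exact: (fd 0).
have ih1 w : `|(f^`())%classic (a + w) - (taylor_poly r (f^`())%classic a).[w]|
    <= B * `|w| ^+ r / r`!%:R.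
  by apply: ih => [k kr x|x]; rewrite -derive1Sn; [exact: fd|exact: fB].
(* The derivative comparison covers only nonnegative increments; [s = -1] reflects the negative
   ones. *)
have step (s : R) v : `|s| = 1 -> 0 <= v ->
    `|f (a + s * v) - (taylor_poly r.+1 f a).[s * v]| <= B * v ^+ r.+1 / r.+1`!%:R.
  move=> s1 v0.
  have -> : B * v ^+ r.+1 / r.+1`!%:R = B / r`!%:R * v ^+ r.+1 / r.+1%:R.
    by rewrite factS natrM [_%:R * _]mulrC invfM mulrA [B * _ / _]mulrAC.
  apply: (@abs_le_of_derivative (fun v => f (a + s * v) - (taylor_poly r.+1 f a).[s * v])
    (fun v => s * ((f^`())%classic (a + s * v) - (taylor_poly r (f^`())%classic a).[s * v]))) => //.
  - move=> w.
    have d1 (c : R) : is_derive w 1 (fun v : R => c + s * v) s.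
      have h : is_derive w 1 ((cst c : R -> R) + (s \*: (id : R -> R))) (0 + s *: 1).
        exact: is_deriveD.
      by rewrite add0r in h; rewrite -[s in is_derive _ _ _ s]mulr1; exact: h.
    rewrite mulrBr; apply: is_deriveB.
      by rewrite mulrC; exact: (@is_derive1_comp _ f (fun v => a + s * v)).
    have h := @is_derive1_comp _ (horner (taylor_poly r.+1 f a)) (fun v => 0 + s * v) w _ _
      (is_derive_poly _ _) (d1 0).
    rewrite mulrC -deriv_taylor_poly.
    have E : (fun v => 0 + s * v) = (fun v => s * v) by apply/funext => v'; rewrite add0r.
    by rewrite add0r in h; rewrite E in h; exact: h.
  - rewrite mulr0 addr0 horner_poly big_ord_recl expr0 mulr1 divr1 big1 ?addr0 ?subrr// => i _.
    by rewrite expr0n mulr0.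
  - move=> w w0; rewrite normrM s1 mul1r (le_trans (ih1 _))// normrM s1 mul1r ger0_norm//.
    by rewrite mulrAC.
have [u0|u0] := leP 0 u.
  by have := step 1 u (normr1 _) u0; rewrite mul1r [`|u|]ger0_norm.
have := step (-1) (- u) (normrN1 _); rewrite mulrNN mul1r [`|u|]ltr0_norm//; apply.
by rewrite oppr_ge0 ltW.
Qed.

End Taylor.

(** * Integrability of products and of test functions from r-th moments *)

Section LrFunctions.
Context {R : realType} {d : measure_display} {T : measurableType d}.
Variables (P : probability T R) (r : nat).
Implicit Types (f g : T -> R).

Definition Lr f := measurable_fun setT f /\
  P.-integrable setT (EFin \o (fun t => `|f t| ^+ r)).

Lemma Rintegral_sum (I : Type) (s : seq I) (f : I -> T -> R) :
  (forall i, P.-integrable setT (EFin \o f i)) ->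
  P.-integrable setT (EFin \o (fun t => \sum_(i <- s) f i t)) /\
  \int[P]_t (\sum_(i <- s) f i t) = \sum_(i <- s) \int[P]_t f i t.
Proof.
move=> fi; elim: s => [|i s [ih1 ih2]].
  split; first by under eq_fun do rewrite /= big_nil; exact: integrable0.
  by rewrite big_nil; under eq_Rintegral do rewrite big_nil; rewrite Rintegral_cst// mul0r.
split.
  rewrite [X in _.-integrable _ X](_ : _ = ((EFin \o f i) \+ (EFin \o (fun t => \sum_(i <- s) f i t)%R))%E).
    exact: integrableD.
  by apply/funext => t /=; rewrite big_cons EFinD.
rewrite big_cons -ih2 -RintegralD//.
by apply: eq_Rintegral => t _; rewrite big_cons.
Qed.

Lemma integrable_bounded f g : measurable_fun setT f ->
  P.-integrable setT (EFin \o g) -> (forall t, `|f t| <= g t) ->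
  P.-integrable setT (EFin \o f).
Proof.
move=> mf ig fg; apply: le_integrable ig => //; first exact/measurable_EFinP.
by move=> t _ /=; rewrite lee_fin (le_trans (fg t))// ler_norm.
Qed.

Lemma integrable_constr (c : R) : P.-integrable setT (EFin \o (fun=> c)).
Proof. exact: finite_measure_integrable_cst. Qed.

Lemma integrableDr f g : P.-integrable setT (EFin \o f) -> P.-integrable setT (EFin \o g) ->
  P.-integrable setT (EFin \o (fun t => f t + g t)).
Proof. by move=> fi gi; exact: (integrableD measurableT fi gi). Qed.

Lemma integrableZr (c : R) f : P.-integrable setT (EFin \o f) ->
  P.-integrable setT (EFin \o (fun t => c * f t)).
Proof. by move=> fi; exact: (integrableZl measurableT c fi). Qed.

Lemma integrable_exp3 f : measurable_fun setT f ->
  (\int[P]_t (`|f t| ^+ 4)%:E < +oo)%E -> P.-integrable setT (EFin \o (fun t => f t ^+ 3)).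
Proof.
move=> mf h4; apply: (@integrable_bounded _ (fun t => 1 + `|f t| ^+ 4)).
- exact: measurable_funX.
- apply: integrableDr; first exact: integrable_constr.
  apply/integrableP; split; last by under eq_integral do rewrite /= ger0_norm ?exprn_ge0//.
  by apply/measurable_EFinP; apply: measurable_funX; exact: measurableT_comp.
- move=> t; rewrite normrX; have [h|h] := leP `|f t| 1.
    by rewrite (le_trans (exprn_ile1 _ _ h))// lerDl exprn_ge0.
  by rewrite (le_trans (ler_weXn2l (ltW h) (leqnSn 3)))// lerDr.
Qed.

(** Every factor is at most b = max(1, max a), and b^r is either 1 or one of the summands. *)
Lemma prod_le_sum_pow (I : finType) (a : I -> R) (s : seq I) : (size s <= r)%N ->
  (forall i, 0 <= a i) -> \prod_(i <- s) a i <= 1 + \sum_i a i ^+ r.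
Proof.
move=> sr a0; case: s sr => [_|i0 s sr].
  by rewrite big_nil lerDl sumr_ge0// => i _; rewrite exprn_ge0.
pose j := [arg max_(i > i0) a i]%O.
have aj i : a i <= a j by rewrite /j; case: arg_maxP => // k _; apply.
pose b := Num.max 1 (a j).
have b1 : 1 <= b by rewrite le_max lexx.
have b0 : 0 <= b by rewrite (le_trans ler01).
have pb (s' : seq I) : \prod_(i <- s') a i <= b ^+ size s'.
  elim: s' => [|i s' ih]; first by rewrite big_nil.
  rewrite big_cons exprS ler_pM//; first by rewrite prodr_ge0.
  by rewrite le_max aj orbT.
apply: (le_trans (pb _)); apply: (@le_trans _ _ (b ^+ r)); first exact: ler_weXn2l.
have sum_ge : a j ^+ r <= \sum_i a i ^+ r.
  by rewrite (bigD1 j)//= lerDl sumr_ge0// => i _; rewrite exprn_ge0.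
rewrite /b; have [_|_] := leP 1 (a j); first by rewrite (le_trans sum_ge)// lerDr.
by rewrite expr1n lerDl sumr_ge0// => i _; rewrite exprn_ge0.
Qed.

Lemma integrable_prod_Lr (I : finType) (g : I -> T -> R) (s : seq I) :
  (size s <= r)%N -> (forall i, Lr (g i)) ->
  P.-integrable setT (EFin \o (fun t => \prod_(i <- s) g i t)).
Proof.
move=> sr hg; apply: (@integrable_bounded _ (fun t => 1 + \sum_i `|g i t| ^+ r)).
- by apply: measurable_prod => i _; exact: (hg i).1.
- apply: integrableDr; first exact: integrable_constr.
  by apply: (Rintegral_sum _ _).1 => i; exact: (hg i).2.
- by move=> t; rewrite normr_prod; exact: prod_le_sum_pow.
Qed.

(** Taylor's formula at 0, where each lower power of |u| is at most 1 + |u|^r. This makes [Psi] of a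
    function in L^r integrable. *)
Lemma growth_bound (Psi : R -> R) (B : R) : Cr_function r Psi ->
  (forall u, `|(Psi^`(r))%classic u| <= B) ->
  exists C, forall u, `|Psi u| <= C * (1 + `|u| ^+ r).
Proof.
move=> [dPsi _] PsiB; have B0 : 0 <= B := le_trans (normr_ge0 _) (PsiB 0).
pose c (k : 'I_r) := `|(Psi^`(k))%classic 0 / k`!%:R|.
exists (\sum_k c k + B / r`!%:R) => u.
have /= := taylor_bound dPsi PsiB 0 u; rewrite add0r => h.
rewrite -[Psi u](subrK (taylor_poly r Psi 0).[u]) (le_trans (ler_normD _ _))//.
rewrite mulrDl addrC lerD//; last first.
  rewrite (le_trans h)// mulrAC ler_wpM2l ?divr_ge0//.
  by rewrite lerDr.
rewrite horner_poly (le_trans (ler_norm_sum _ _ _))// mulr_suml ler_sum// => k _.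
rewrite normrM ler_wpM2l// normrX.
have [u1|u1] := leP 1 `|u|.
  by rewrite (le_trans (ler_weXn2l u1 (ltnW (ltn_ord k))))// lerDr.
have u0 : 0 <= `|u| by []; rewrite (le_trans (exprn_ile1 k u0 (ltW u1)))//.
by rewrite lerDl exprn_ge0.
Qed.

Lemma integrable_Psi (Psi : R -> R) (B : R) f : Cr_function r Psi ->
  (forall u, `|(Psi^`(r))%classic u| <= B) -> Lr f ->
  P.-integrable setT (EFin \o (Psi \o f)).
Proof.
move=> CPsi PsiB [mf fi]; have [C hC] := growth_bound CPsi PsiB.
have mPsi : measurable_fun setT Psi.
  by apply: continuous_measurable_fun; exact: (CPsi.2 0%N).
apply: (@integrable_bounded _ (fun t => C * (1 + `|f t| ^+ r))).
- exact: measurableT_comp.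
- by apply: integrableZr; apply: integrableDr => //; exact: integrable_constr.
- by move=> t; exact: hC.
Qed.

End LrFunctions.

(** * Lindeberg replacement *)

Section CoordinatePart.
Context {R : realType} {n : nat} {m : 'I_n -> nat}.
Implicit Types (Q : mlpoly R m) (w p : forall i, 'I_(m i).+1 -> R).

(** For orthonormal ensembles this is [Q] minus its conditional expectation given the coordinates
    other than [k]. *)
Definition ml_coord_part (k : 'I_n) Q : mlpoly R m :=
  [ffun s : multi_index m => if s k == ord0 then 0 else Q s].

Definition ml_freeze (k : 'I_n) p Q : mlpoly R m :=
  [ffun b : multi_index m => ml_eval (ml_part [set~ k]%SET Q b) p].

Definition ml_mono (s : multi_index m) : mlpoly R m := [ffun s' : multi_index m => (s' == s)%:R].

Lemma ml_eval_mono s w : ml_eval (ml_mono s) w = \prod_(i < n) w i (s i).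
Proof.
rewrite /ml_eval (bigD1 s)//= ffunE eqxx mul1r [X in _ + X]big1 ?addr0// => s' s's.
by rewrite ffunE (negPf s's) mul0r.
Qed.

Lemma ml_eval_freeze k p Q w : (forall i, p i ord0 = 1) -> (forall i, w i ord0 = 1) ->
  ml_eval Q (pt_merge [set~ k]%SET p w) = ml_eval (ml_freeze k p Q) w.
Proof.
move=> p1 w1; rewrite -[Q in LHS]ml_noise1 ml_eval_merge// ml_noise1; congr ml_eval.
by apply/ffunP => b; rewrite !ffunE ml_noise1.
Qed.

Lemma ml_freeze_supported k p Q : ml_supported [set k]%SET (ml_freeze k p Q).
Proof.
have hT : ml_supported [set: 'I_n]%SET Q by move=> s _; exact: finset.subsetT.
move=> s hs.
have := @ml_part_supportedr _ _ _ [set~ k]%SET _ Q (fun q => ml_eval q p) (ml_eval0 p) hT s hs.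
suff -> : [set: 'I_n]%SET :\: [set~ k]%SET = [set k]%SET by [].
by apply/setP => i; rewrite !inE negbK andbT.
Qed.

Lemma ml_coord_part_freeze k p Q :
  ml_coord_part k (ml_freeze k p Q) = ml_freeze k p (ml_coord_part k Q).
Proof.
apply/ffunP => b; rewrite !ffunE; case: ifPn => bk.
  rewrite (_ : ml_part _ (ml_coord_part k Q) b = 0) ?ml_eval0//.
  apply/ffunP => a; rewrite !ffunE; case: ifP => // _.
  by rewrite !inE eqxx/= bk.
congr ml_eval; apply/ffunP => a; rewrite !ffunE !inE eqxx/=.
by rewrite (negPf bk).
Qed.

Lemma mi_supp1_eq k (s s' : multi_index m) : mi_supp s \subset [set k]%SET ->
  mi_supp s' \subset [set k]%SET -> (s == s') = (s k == s' k).
Proof.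
move=> /mi_suppP hs /mi_suppP hs'; apply/eqP/eqP => [->//|e].
apply: mi_ext => i; have [->//|ik] := eqVneq i k.
by rewrite hs ?hs' ?inE.
Qed.

Lemma ml_eval_coord k q w : (forall i, w i ord0 = 1) -> ml_supported [set k]%SET q ->
  ml_eval q w = \sum_b q b * w k (b k).
Proof.
move=> w1 qk; apply: eq_bigr => b _; have [->|/qk/mi_suppP hb] := eqVneq (q b) 0.
  by rewrite !mul0r.
rewrite (bigD1 k)//= big1 ?mulr1// => i ik.
by rewrite hb ?inE// w1.
Qed.

Lemma ml_eval_coord_part k q w : (forall i, w i ord0 = 1) -> ml_supported [set k]%SET q ->
  ml_eval q w = q mi_zero + ml_eval (ml_coord_part k q) w.
Proof.
move=> w1 qk; rewrite /ml_eval (bigD1 mi_zero)//=; congr (_ + _).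
  by rewrite big1 ?mulr1// => i _; rewrite ffunE w1.
rewrite [RHS](bigD1 mi_zero)//= !ffunE eqxx mul0r add0r.
apply: eq_bigr => s s0; rewrite ffunE; case: eqP => // sk.
have [->//|/qk hs] := eqVneq (q s) 0.
move: s0; rewrite (mi_supp1_eq hs); first by rewrite ffunE sk eqxx.
by apply/mi_suppP => i _; rewrite ffunE.
Qed.

Lemma ml_coord_part_supported k S q : ml_supported S q -> ml_supported S (ml_coord_part k q).
Proof. by move=> qS s; rewrite ffunE; case: ifP => [|_ /qS//]; rewrite eqxx. Qed.

Lemma ml_coord_part_norm2 k Q : ml_norm2 (ml_coord_part k Q) = ml_inf Q k.
Proof.
rewrite /ml_inf big_mkcond; apply: eq_bigr => s _; rewrite ffunE.
by case: eqP => //=; rewrite expr0n.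
Qed.

End CoordinatePart.

Section Lindeberg.
Context {R : realType} {n : nat} {m : 'I_n -> nat}.
Context {d : measure_display} {T : measurableType d} (P : probability T R).

(** What the replacement argument asks of every hybrid; orthonormality is absent, its effect being
    contained in the moment bound. *)
Record good_family (r : nat) (eta : R) (x : forall i : 'I_n, 'I_(m i).+1 -> T -> R) : Prop :=
  GoodFamily {
    gf_measurable : measurable_family x;
    gf_independent : independent_coords P x;
    gf_one : forall i t, x i ord0 t = 1;
    gf_bound : moment_bound P x r eta [set: 'I_n]%SET
  }.

(** Since [eta] is nonzero the noise operator is invertible, so every polynomial is a noisy one and
    the moment bound makes its r-th moment finite. *)
Lemma ml_eval_Lr r eta x (Q : mlpoly R m) : 0 < eta -> good_family r eta x ->
  Lr P r (fun t => ml_eval Q (sample x t)).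
Proof.
move=> eta0 [mx _ _ hx].
have mQ : measurable_fun setT (fun t => ml_eval Q (sample x t)).
  by apply: measurable_ml_eval => i j; exact: mx.
split => //; apply/integrableP; split.
  by apply/measurable_EFinP; apply: measurable_funX; exact: measurableT_comp.
have EQ : Q = ml_noise eta (ml_noise eta^-1 Q).
  by apply/ffunP => s; rewrite !ffunE mulrA exprVn mulfV ?mul1r// expf_neq0// gt_eqF.
under eq_integral do rewrite /= ger0_norm ?exprn_ge0//.
rewrite EQ; apply: le_lt_trans (hx _ _) _; last exact: ltry.
by move=> s _; exact: finset.subsetT.
Qed.

Section OneCoordinate.
Variables (r : nat) (eta : R) (k : 'I_n).
Variables x y : forall i : 'I_n, 'I_(m i).+1 -> T -> R.
Arguments x : clear implicits.
Arguments y : clear implicits.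
Hypotheses (eta0 : 0 < eta) (gx : good_family r eta x) (gy : good_family r eta y).
Hypothesis xy_moments : forall S : seq 'I_(m k).+1, (size S < r)%N ->
  \int[P]_t (\prod_(j <- S) x k j t) = \int[P]_t (\prod_(j <- S) y k j t).

Let coord_Lr z (gz : good_family r eta z) (b : multi_index m) : Lr P r (z k (b k)).
Proof.
(* A single variable is the value of a monomial: the merged index is [b k] at [k] and 0
   elsewhere. *)
have -> : z k (b k) = fun t => ml_eval (ml_mono (mi_merge [set~ k]%SET mi_zero b)) (sample z t).
  apply/funext => t; rewrite ml_eval_mono (bigD1 k)//= big1 ?mulr1 => [|i ik].
    by rewrite ffunE !inE eqxx.
  by rewrite !ffunE !inE ik; exact: (gf_one gz).
exact: (ml_eval_Lr _ eta0 gz).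
Qed.

Let prod_integrable z (gz : good_family r eta z) (q : mlpoly R m) (S : seq (multi_index m)) j :
  (size S + j <= r)%N -> P.-integrable setT (EFin \o
    (fun t => (\prod_(b <- S) z k (b k) t) * ml_eval q (sample z t) ^+ j)).
Proof.
move=> sj.
(* The two kinds of factors become one finite family: [Some b] is a variable, [None] the polynomial
   [q]. *)
pose g (o : option (multi_index m)) t :=
  if o is Some b then z k (b k) t else ml_eval q (sample z t).
have := @integrable_prod_Lr _ _ _ P r _ g (map Some S ++ nseq j None).
rewrite size_cat size_map size_nseq => /(_ sj) h.
rewrite (_ : (fun t => _) = (fun t => \prod_(i <- map Some S ++ nseq j None) g i t)).
  by apply: h => -[b|]; [exact: coord_Lr|exact: (ml_eval_Lr _ eta0 gz)].
by apply/funext => t; rewrite big_cat big_map big_nseq /= iter_mulr_1.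
Qed.

(** Induction on [j]: one factor [q], linear in the variables of coordinate [k], is expanded and the
    resulting variable joins [S]. The total number of factors is unchanged. *)
Lemma moments_agree (q : mlpoly R m) (j : nat) (S : seq (multi_index m)) :
  ml_supported [set k]%SET q -> (size S + j < r)%N ->
  \int[P]_t ((\prod_(b <- S) x k (b k) t) * ml_eval q (sample x t) ^+ j) =
  \int[P]_t ((\prod_(b <- S) y k (b k) t) * ml_eval q (sample y t) ^+ j).
Proof.
move=> qk; elim: j S => [|j ih] S.
  rewrite addn0 => Sr; under eq_Rintegral do rewrite expr0 mulr1.
  under [RHS]eq_Rintegral do rewrite expr0 mulr1.
  have := @xy_moments [seq b k | b : multi_index m <- S]; rewrite size_map => /(_ Sr).
  by under eq_Rintegral do rewrite big_map; under [RHS]eq_Rintegral do rewrite big_map.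
move=> Sj.
have E z (gz : good_family r eta z) :
    \int[P]_t ((\prod_(b <- S) z k (b k) t) * ml_eval q (sample z t) ^+ j.+1) =
    \sum_b q b * \int[P]_t ((\prod_(b' <- b :: S) z k (b' k) t) * ml_eval q (sample z t) ^+ j).
  have sj (b : multi_index m) : (size (b :: S) + j <= r)%N by rewrite /= addSnnS ltnW.
  have bi b := prod_integrable gz q (sj b).
  have zi b := integrableZr (q b) (bi b).
  transitivity (\sum_b \int[P]_t (q b *
      ((\prod_(b' <- b :: S) z k (b' k) t) * ml_eval q (sample z t) ^+ j))); last first.
    by apply: eq_bigr => b _; rewrite RintegralZl.
  rewrite -(Rintegral_sum _ zi).2; apply: eq_Rintegral => t _.
  have z1 i : sample z t i ord0 = 1 by exact: (gf_one gz).
  rewrite exprSr [X in _ * (_ * X) = _](ml_eval_coord z1 qk) mulrA mulr_sumr.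
  by apply: eq_bigr => b _; rewrite big_cons -[sample z t k (b k)]/(z k (b k) t); ring.
rewrite !E//; apply: eq_bigr => b _; rewrite ih//= addSnnS.
exact: Sj.
Qed.

Variables (Psi : R -> R) (B : R).
Hypotheses (CPsi : Cr_function r Psi) (PsiB : forall u, `|(Psi^`(r))%classic u| <= B).

Lemma lindeberg_point (q : mlpoly R m) : ml_supported [set k]%SET q ->
  `|\int[P]_t Psi (ml_eval q (sample x t)) - \int[P]_t Psi (ml_eval q (sample y t))| <=
  B / r`!%:R * (\int[P]_t (`|ml_eval (ml_coord_part k q) (sample x t)| ^+ r)
              + \int[P]_t (`|ml_eval (ml_coord_part k q) (sample y t)| ^+ r)).
Proof.
move=> qk; set u := ml_coord_part k q; set a := q mi_zero.
have uk : ml_supported [set k]%SET u by exact: ml_coord_part_supported.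
pose rem v := Psi (a + v) - (taylor_poly r Psi a).[v].
have E z (gz : good_family r eta z) :
    P.-integrable setT (EFin \o (fun t => rem (ml_eval u (sample z t)))) /\
    \int[P]_t Psi (ml_eval q (sample z t)) =
    \int[P]_t rem (ml_eval u (sample z t)) +
    \sum_(j < r) (taylor_poly r Psi a)`_j * \int[P]_t (ml_eval u (sample z t) ^+ j).
  have eqz t : ml_eval q (sample z t) = a + ml_eval u (sample z t).
    by apply: ml_eval_coord_part => // i; exact: (gf_one gz).
  have iPsi : P.-integrable setT (EFin \o (fun t => Psi (a + ml_eval u (sample z t)))).
    under eq_fun do rewrite /= -eqz.
    by apply: (integrable_Psi CPsi PsiB); exact: (ml_eval_Lr _ eta0 gz).
  have ij (j : 'I_r) : P.-integrable setT (EFin \o (fun t => ml_eval u (sample z t) ^+ j)).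
    have := @prod_integrable z gz u [::] j; rewrite add0n => /(_ (ltnW (ltn_ord j))).
    by under eq_fun do rewrite /= big_nil mul1r.
  have [iT eT] := Rintegral_sum (index_enum 'I_r)
    (fun j => integrableZr (taylor_poly r Psi a)`_j (ij j)).
  have TE v : (taylor_poly r Psi a).[v] = \sum_(j < r) (taylor_poly r Psi a)`_j * v ^+ j.
    by rewrite horner_poly; apply: eq_bigr => j _; rewrite coef_poly ltn_ord.
  have irem : P.-integrable setT (EFin \o (fun t => rem (ml_eval u (sample z t)))).
    rewrite (_ : (fun t => _) = fun t => Psi (a + ml_eval u (sample z t)) +
      (-1) * \sum_(j < r) (taylor_poly r Psi a)`_j * ml_eval u (sample z t) ^+ j).
      by apply: integrableDr => //; exact: integrableZr.
    by apply/funext => t; rewrite /rem TE mulN1r.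
  split => //.
  transitivity (\int[P]_t (rem (ml_eval u (sample z t)) +
      \sum_(j < r) (taylor_poly r Psi a)`_j * ml_eval u (sample z t) ^+ j)).
    by apply: eq_Rintegral => t _; rewrite eqz /rem TE subrK.
  rewrite RintegralD// eT; congr (_ + _); apply: eq_bigr => j _.
  by rewrite RintegralZl.
have [ix ->] := E x gx; have [iy ->] := E y gy.
have -> : \sum_(j < r) (taylor_poly r Psi a)`_j * \int[P]_t (ml_eval u (sample y t) ^+ j) =
    \sum_(j < r) (taylor_poly r Psi a)`_j * \int[P]_t (ml_eval u (sample x t) ^+ j).
  apply: eq_bigr => j _; congr (_ * _).
  have := @moments_agree u j [::] uk; rewrite add0n => /(_ (ltn_ord j)).
  by under eq_Rintegral do rewrite big_nil mul1r; under [RHS]eq_Rintegral do rewrite big_nil mul1r.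
rewrite opprD addrACA subrr addr0.
have B' z (gz : good_family r eta z) :
    P.-integrable setT (EFin \o (fun t => rem (ml_eval u (sample z t)))) ->
    `|\int[P]_t rem (ml_eval u (sample z t))| <=
    B / r`!%:R * \int[P]_t (`|ml_eval u (sample z t)| ^+ r).
  move=> irem; have [_ iL] := ml_eval_Lr u eta0 gz.
  rewrite (le_trans (le_normr_Rintegral _ irem))// -RintegralZl//.
  apply: le_Rintegral => //.
  - by apply/integrable_norm.
  - exact: integrableZr.
  - move=> t _; rewrite mulrAC; apply: taylor_bound => //; exact: CPsi.1.
by rewrite mulrDr (le_trans (ler_normB _ _))// lerD// B'.
Qed.

End OneCoordinate.
End Lindeberg.

Section Swap.
Context {R : realType} {n : nat} {m : 'I_n -> nat}.

Lemma ml_freeze_eq (k : 'I_n) (p p' : forall i, 'I_(m i).+1 -> R) (Q : mlpoly R m) :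
  (forall i, p i ord0 = 1) -> (forall i, p' i ord0 = 1) ->
  (forall i, i != k -> p i = p' i) -> ml_freeze k p Q = ml_freeze k p' Q.
Proof.
move=> p1 p1' pp'; apply/ffunP => b; rewrite !ffunE; apply: eq_bigr => a _.
rewrite ffunE; case: ifPn => [/andP[/mi_suppP ha _]|]; last by rewrite !mul0r.
congr (_ * _); apply: eq_bigr => i _.
have [->|ik] := eqVneq i k; last by rewrite pp'.
by rewrite ha ?inE ?eqxx// p1 p1'.
Qed.

Context {d : measure_display} {T : measurableType d} (P : probability T R).
Variables (r : nat) (eta : R).
Hypothesis eta0 : 0 < eta.

Lemma freeze_Rintegral (x : forall i : 'I_n, 'I_(m i).+1 -> T -> R) (k : 'I_n)
    (Q : mlpoly R m) (phi : R -> R) : good_family P r eta x ->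
  measurable_fun setT phi ->
  (forall q : mlpoly R m, P.-integrable setT (EFin \o (fun t => phi (ml_eval q (sample x t))))) ->
  P.-integrable setT (EFin \o (fun t =>
    \int[P]_s phi (ml_eval (ml_freeze k (sample x t) Q) (sample x s)))) /\
  \int[P]_t phi (ml_eval Q (sample x t)) =
  \int[P]_t \int[P]_s phi (ml_eval (ml_freeze k (sample x t) Q) (sample x s)).
Proof.
move=> gx mphi iphi; have [mx ix x1 _] := gx.
have mphi' : measurable_fun setT (EFin \o phi) by exact/measurable_EFinP.
have [iF eF] := freeze k mx ix mphi' (iphi Q).
have E t : (\int[P]_s (EFin \o phi) (ml_eval Q (pt_merge [set~ k]%SET (sample x t) (sample x s))))%E
    = (\int[P]_s phi (ml_eval (ml_freeze k (sample x t) Q) (sample x s)))%:E.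
  rewrite /Rintegral fineK; last exact: integrable_fin_num (iphi _).
  apply: eq_integral => s _ /=; rewrite ml_eval_freeze// => i; exact: x1.
split; first by apply: eq_integrable iF => // t _; rewrite E.
by rewrite /Rintegral; congr fine; rewrite [LHS]eF; apply: eq_integral => t _; rewrite E.
Qed.

Variables (Psi : R -> R) (B : R).
Hypotheses (CPsi : Cr_function r Psi) (PsiB : forall u, `|(Psi^`(r))%classic u| <= B).

(** Both outer integrals run over the same [t], where the two frozen polynomials coincide; the
    one-coordinate estimate then applies under the integral sign. *)
Lemma lindeberg_swap (x y : forall i : 'I_n, 'I_(m i).+1 -> T -> R) (k : 'I_n) (Q : mlpoly R m) :
  good_family P r eta x -> good_family P r eta y ->
  (forall i, i != k -> x i = y i) ->
  (forall S : seq 'I_(m k).+1, (size S < r)%N ->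
    \int[P]_t (\prod_(j <- S) x k j t) = \int[P]_t (\prod_(j <- S) y k j t)) ->
  `|\int[P]_t Psi (ml_eval Q (sample x t)) - \int[P]_t Psi (ml_eval Q (sample y t))| <=
  B / r`!%:R * (\int[P]_t (`|ml_eval (ml_coord_part k Q) (sample x t)| ^+ r)
              + \int[P]_t (`|ml_eval (ml_coord_part k Q) (sample y t)| ^+ r)).
Proof.
move=> gx gy xy mom.
have mPsi : measurable_fun setT Psi.
  by apply: continuous_measurable_fun; exact: (CPsi.2 0%N).
have mpow : measurable_fun setT (fun u : R => `|u| ^+ r).
  by apply: measurable_funX; exact: normr_measurable.
have iPsi z (gz : good_family P r eta z) (q : mlpoly R m) :
    P.-integrable setT (EFin \o (fun t => Psi (ml_eval q (sample z t)))).
  by apply: (integrable_Psi CPsi PsiB); exact: (ml_eval_Lr _ eta0 gz).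
have ipow z (gz : good_family P r eta z) (q : mlpoly R m) :
    P.-integrable setT (EFin \o (fun t => `|ml_eval q (sample z t)| ^+ r)).
  exact: (ml_eval_Lr _ eta0 gz).2.
have [iFx ->] := freeze_Rintegral k Q gx mPsi (iPsi _ gx).
have [iFy ->] := freeze_Rintegral k Q gy mPsi (iPsi _ gy).
have [iGx ->] := freeze_Rintegral k (ml_coord_part k Q) gx mpow (ipow _ gx).
have [iGy ->] := freeze_Rintegral k (ml_coord_part k Q) gy mpow (ipow _ gy).
rewrite -RintegralB// -RintegralD// -RintegralZl//; last exact: integrableDr.
have iFxy : P.-integrable setT (EFin \o (fun t =>
    \int[P]_s Psi (ml_eval (ml_freeze k (sample x t) Q) (sample x s)) -
    \int[P]_s Psi (ml_eval (ml_freeze k (sample y t) Q) (sample y s)))).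
  exact: (integrableB measurableT iFx iFy).
rewrite (le_trans (le_normr_Rintegral _ iFxy))//; apply: le_Rintegral => //.
- exact: integrable_norm.
- by apply: integrableZr; exact: integrableDr.
- move=> t _ /=; rewrite -!ml_coord_part_freeze.
  have -> : ml_freeze k (sample y t) Q = ml_freeze k (sample x t) Q.
    apply: ml_freeze_eq => [i|i|i ik]; [exact: (gf_one gy)|exact: (gf_one gx)|].
    by apply/funext => j; rewrite /sample xy.
  by apply: (lindeberg_point eta0 gx gy mom CPsi PsiB); exact: ml_freeze_supported.
Qed.

(** The moment bound is applied to the inverse noise of [q]. As [eta <= 1], this multiplies each
    coefficient by at most eta^(-D), hence the squared norm by at most eta^(-2D). *)
Lemma moment_coord_part (x : forall i : 'I_n, 'I_(m i).+1 -> T -> R) (k : 'I_n)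
    (Q : mlpoly R m) (D : nat) : good_family P r eta x -> eta <= 1 -> (ml_deg Q <= D)%N ->
  \int[P]_t (`|ml_eval (ml_coord_part k Q) (sample x t)| ^+ r) <=
  eta ^- (r * D) * Num.sqrt (ml_inf Q k) ^+ r.
Proof.
move=> gx eta1 QD; set q := ml_coord_part k Q.
have eta_n0 : eta != 0 by rewrite gt_eqF.
have Eq : q = ml_noise eta (ml_noise eta^-1 q).
  by apply/ffunP => s; rewrite !ffunE mulrA exprVn mulfV ?mul1r// expf_neq0.
have nq : ml_norm2 (ml_noise eta^-1 q) <= (eta ^- D) ^+ 2 * ml_inf Q k.
  rewrite -ml_coord_part_norm2 -/q /ml_norm2 mulr_sumr; apply: ler_sum => s _.
  rewrite [ml_noise _ _ _]ffunE exprMn; have [->|qs] := eqVneq (q s) 0; first by rewrite expr0n !mulr0.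
  rewrite ler_wpM2r ?sqr_ge0// lerXn2r ?nnegrE ?exprn_ge0 ?invr_ge0 ?exprn_ge0 ?(ltW eta0)//.
  rewrite -exprVn ler_weXn2l ?invf_ge1//; apply: leq_trans QD.
  apply: (leq_bigmax_cond (F := fun s : multi_index m => mi_size s)); move: qs; rewrite /q ffunE.
  by case: ifP; rewrite ?eqxx.
have hT : ml_supported [set: 'I_n]%SET (ml_noise eta^-1 q) by move=> s _; exact: finset.subsetT.
have h := gf_bound gx hT; rewrite -Eq in h.
have iq := (ml_eval_Lr q eta0 gx).2.
have h' : \int[P]_t (`|ml_eval q (sample x t)| ^+ r) <= Num.sqrt (ml_norm2 (ml_noise eta^-1 q)) ^+ r.
  by rewrite -lee_fin /Rintegral fineK//; exact: integrable_fin_num iq.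
apply: (le_trans h'); rewrite mulnC exprM -exprVn -exprMn lerXn2r ?nnegrE ?sqrtr_ge0//.
  by rewrite mulr_ge0 ?sqrtr_ge0// invr_ge0 exprn_ge0// ltW.
rewrite -[eta ^- D]ger0_norm ?invr_ge0 ?exprn_ge0 ?(ltW eta0)// -sqrtr_sqr -sqrtrM ?sqr_ge0//.
exact: ler_wsqrtr.
Qed.

(** Telescoping by induction on the size of [M], removing one coordinate at a time. *)
Lemma lindeberg_chain (z : {set 'I_n} -> forall i : 'I_n, 'I_(m i).+1 -> T -> R)
    (Q : mlpoly R m) (D : nat) : eta <= 1 -> (ml_deg Q <= D)%N ->
  (forall M, good_family P r eta (z M)) ->
  (forall (M : {set 'I_n}) k i, i != k -> z M i = z (M :\ k)%SET i) ->
  (forall (M : {set 'I_n}) k, k \in M -> forall S : seq 'I_(m k).+1, (size S < r)%N ->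
    \int[P]_t (\prod_(j <- S) z M k j t) = \int[P]_t (\prod_(j <- S) z (M :\ k)%SET k j t)) ->
  forall M : {set 'I_n},
  `|\int[P]_t Psi (ml_eval Q (sample (z M) t)) -
    \int[P]_t Psi (ml_eval Q (sample (z finset.set0) t))| <=
  \sum_(k in M) 2 * B / r`!%:R * eta ^- (r * D) * Num.sqrt (ml_inf Q k) ^+ r.
Proof.
move=> eta1 QD gz zk zmom M; have B0 : 0 <= B := le_trans (normr_ge0 _) (PsiB 0).
have [N] := ubnP #|M|; elim: N M => // N ih M; rewrite ltnS => MN.
have [->|[k kM]] := set_0Vmem M; first by rewrite subrr normr0 big_set0.
rewrite (big_setD1 k kM)/=.
have -> : \int[P]_t Psi (ml_eval Q (sample (z M) t)) -
    \int[P]_t Psi (ml_eval Q (sample (z finset.set0) t)) =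
  (\int[P]_t Psi (ml_eval Q (sample (z M) t)) -
    \int[P]_t Psi (ml_eval Q (sample (z (M :\ k)%SET) t))) +
  (\int[P]_t Psi (ml_eval Q (sample (z (M :\ k)%SET) t)) -
    \int[P]_t Psi (ml_eval Q (sample (z finset.set0) t))).
  by rewrite addrA subrK.
rewrite (le_trans (ler_normD _ _))// lerD//; last first.
  by apply: ih; rewrite (leq_trans _ MN)//; apply: proper_card; exact: properD1.
apply: (le_trans (lindeberg_swap Q (gz M) (gz (M :\ k)%SET) (zk M k) (zmom M k kM))).
(* The factor 2 stands for the two remainders, of the old and of the new coordinate, which have the
   same bound. *)
have -> : 2 * B / r`!%:R * eta ^- (r * D) * Num.sqrt (ml_inf Q k) ^+ r =
  B / r`!%:R * (eta ^- (r * D) * Num.sqrt (ml_inf Q k) ^+ r +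
                eta ^- (r * D) * Num.sqrt (ml_inf Q k) ^+ r) by ring.
rewrite ler_wpM2l ?divr_ge0// lerD//; exact: moment_coord_part.
Qed.

End Swap.

(** * The invariance estimate from moment bounds *)

Section Invariance.
Context {R : realType} {n : nat} {m : 'I_n -> nat}.

(** A multi-index is counted once for each coordinate it uses, that is at most [D] times. *)
Lemma sum_ml_inf (Q : mlpoly R m) (D : nat) : (ml_deg Q <= D)%N ->
  \sum_k ml_inf Q k <= D%:R * ml_var Q.
Proof.
move=> QD; rewrite /ml_inf (exchange_big_dep xpredT)//= /ml_var big_mkcond mulr_sumr [leRHS]big_mkcond /=.
apply: ler_sum => s _; rewrite sumr_const.
have -> : #|[pred i | s i != ord0]| = mi_size s by [].
case: ifPn => [_|]; last first.
  by rewrite lt0n negbK => /eqP ->; rewrite mulr0n.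
rewrite -[leLHS]mulr_natl; have [->|qs] := eqVneq (Q s) 0; first by rewrite expr0n/= !mulr0.
rewrite ler_wpM2r ?sqr_ge0// ler_nat (leq_trans _ QD)//.
exact: (leq_bigmax_cond (F := fun s : multi_index m => mi_size s)).
Qed.

(** One factor Inf_k is kept for the sum and the remaining power r/2 - 1 is bounded by that of
    [tau]. *)
Lemma sum_sqrt_inf (Q : mlpoly R m) (r D : nat) (tau : R) : (3 <= r)%N ->
  (forall i, ml_inf Q i <= tau) -> 0 <= tau -> ml_var Q <= 1 -> (ml_deg Q <= D)%N ->
  \sum_k Num.sqrt (ml_inf Q k) ^+ r <= D%:R * tau `^ (r%:R / 2 - 1).
Proof.
move=> r3 Qtau tau0 Qvar QD.
have -> : tau `^ (r%:R / 2 - 1) = Num.sqrt tau ^+ (r - 2).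
  rewrite -powR12_sqrt// -powR_mulrn ?powR_ge0// -powRrM; congr (_ `^ _).
  by rewrite natrB ?(ltnW r3)//; lra.
have I0 k : 0 <= ml_inf Q k by apply: sumr_ge0 => s _; exact: sqr_ge0.
apply: (@le_trans _ _ (\sum_k Num.sqrt tau ^+ (r - 2) * ml_inf Q k)).
  apply: ler_sum => k _; rewrite -[r in _ ^+ r](subnK (ltnW r3)) exprD sqr_sqrtr//.
  by rewrite ler_wpM2r// lerXn2r ?nnegrE ?sqrtr_ge0// ler_wsqrtr.
rewrite -mulr_sumr mulrC ler_wpM2r ?exprn_ge0 ?sqrtr_ge0//.
rewrite (le_trans (sum_ml_inf QD))// -[leRHS]mulr1 ler_wpM2l//.
Qed.

Context {dX dY : measure_display} {TX : measurableType dX} {TY : measurableType dY}.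
Variables (PX : probability TX R) (PY : probability TY R).
Variables (X : ensembles PX m) (Y : ensembles PY m).
Arguments X : clear implicits.
Arguments Y : clear implicits.

(** The common core of the four cases: each of them only has to supply matching moments and the two
    moment bounds for its own [r] and [eta]. *)
Lemma invariance (Q : mlpoly R m) (r D : nat) (eta tau B : R) (Psi : R -> R) :
  (0 < n)%N -> ensemble_sequence X -> ensemble_sequence Y ->
  ml_var Q <= 1 -> (ml_deg Q <= D)%N -> (forall i, ml_inf Q i <= tau) ->
  Cr_function r Psi -> (forall u, `|(Psi^`(r))%classic u| <= B) ->
  (3 <= r)%N -> 0 < eta <= 1 -> matching_moments X Y r ->
  moment_bound PX (fun i j => X i j : TX -> R) r eta [set: 'I_n]%SET ->
  moment_bound PY (fun i j => Y i j : TY -> R) r eta [set: 'I_n]%SET ->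
  (expectation_gap PX PY (Psi \o ml_subst Q X) (Psi \o ml_subst Q Y)
    <= ((2 * B / r`!%:R) * D%:R * eta ^- (r * D) * tau `^ (r%:R / 2 - 1))%:E)%E.
Proof.
move=> n0 [oX iX] [oY iY] Qvar QD Qtau CPsi PsiB r3 /andP[eta0 eta1] mom hX hY.
have B0 : 0 <= B := le_trans (normr_ge0 _) (PsiB 0).
have I0 k : 0 <= ml_inf Q k by apply: sumr_ge0 => s _; exact: sqr_ge0.
(* A coordinate exists, and its influence is a nonnegative number below [tau]. *)
have tau0 : 0 <= tau := le_trans (I0 (Ordinal n0)) (Qtau _).
pose x : forall i : 'I_n, 'I_(m i).+1 -> TX -> R := fun i j => X i j.
pose y : forall i : 'I_n, 'I_(m i).+1 -> TY -> R := fun i j => Y i j.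
have mx : measurable_family x by move=> i j; exact: measurable_funPT.
have my : measurable_family y by move=> i j; exact: measurable_funPT.
have x1 i t : x i ord0 t = 1 := (oX i).1 t.
have y1 i t : y i ord0 t = 1 := (oY i).1 t.
have r2 : (2 <= r)%N := ltnW r3.
pose P := prod_prob PX PY; pose z M := hybrid x y M.
have gz M : good_family P r eta (z M).
  split.
  - exact: measurable_hybrid.
  - exact: independent_hybrid.
  - by move=> i t; rewrite /z /hybrid /pt_merge; case: (i \in M); [exact: x1|exact: y1].
  - exact: moment_bound_hybrid.
have zk (M : {set 'I_n}) k i : i != k -> z M i = z (M :\ k)%SET i.
  by move=> ik; rewrite /z /hybrid /pt_merge !inE ik.
have mPsi : measurable_fun setT Psi.
  by apply: continuous_measurable_fun; exact: (CPsi.2 0%N).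
have zmom (M : {set 'I_n}) k : k \in M -> forall S : seq 'I_(m k).+1, (size S < r)%N ->
    \int[P]_t (\prod_(j <- S) z M k j t) = \int[P]_t (\prod_(j <- S) z (M :\ k)%SET k j t).
  move=> kM S Sr.
  have -> : z M k = (fun j t => x k j t.1) by exact: hybrid_in.
  have -> : z (M :\ k)%SET k = (fun j t => y k j t.2) by apply: hybrid_notin; rewrite !inE eqxx.
  rewrite /Rintegral; congr fine.
  rewrite (integral_prod_fst PX PY (f := fun t => (\prod_(j <- S) x k j t)%:E)).
    rewrite (integral_prod_snd PX PY (f := fun t => (\prod_(j <- S) y k j t)%:E)).
      by have := mom k S Sr; rewrite unlock.
    by apply/measurable_EFinP; apply: measurable_prod => j _; exact: my.
  by apply/measurable_EFinP; apply: measurable_prod => j _; exact: mx.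
have := lindeberg_chain eta0 CPsi PsiB eta1 QD gz zk zmom [set: 'I_n]%SET.
rewrite -mulr_sumr (eq_bigl xpredT) => [h|k]; last by rewrite inE.
have c0 : 0 <= 2 * B / r`!%:R * eta ^- (r * D).
  by rewrite !mulr_ge0 ?invr_ge0 ?exprn_ge0 ?(ltW eta0).
have {}h := le_trans h (ler_wpM2l c0
  (sum_sqrt_inf r3 Qtau tau0 Qvar QD)).
(* Integrability makes both expectations real, so that the extended-real gap is a genuine
   distance. *)
have iz M : P.-integrable setT (EFin \o (fun t => Psi (ml_eval Q (sample (z M) t)))).
  by apply: (integrable_Psi CPsi PsiB); exact: (ml_eval_Lr _ eta0 (gz M)).
have EX : ('E_PX[Psi \o ml_subst Q X] =
    (\int[P]_t Psi (ml_eval Q (sample (z [set: 'I_n]%SET) t)))%:E)%E.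
  rewrite /Rintegral fineK; last exact: (integrable_fin_num measurableT (iz _)).
  rewrite unlock -(integral_prod_fst PX PY (f := fun t => (Psi (ml_subst Q X t))%:E)).
    apply: eq_integral => t _; congr ((Psi _)%:E); apply: eq_bigr => s _; congr (_ * _).
    by apply: eq_bigr => i _; rewrite /sample /z /hybrid /pt_merge inE.
  apply/measurable_EFinP; apply: (measurableT_comp mPsi).
  by apply: (measurable_ml_eval (z := sample x)) => i j; exact: mx.
have EY : ('E_PY[Psi \o ml_subst Q Y] =
    (\int[P]_t Psi (ml_eval Q (sample (z finset.set0) t)))%:E)%E.
  rewrite /Rintegral fineK; last exact: (integrable_fin_num measurableT (iz _)).
  rewrite unlock -(integral_prod_snd PX PY (f := fun t => (Psi (ml_subst Q Y t))%:E)).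
    apply: eq_integral => t _; congr ((Psi _)%:E); apply: eq_bigr => s _; congr (_ * _).
    by apply: eq_bigr => i _; rewrite /sample /z /hybrid /pt_merge inE.
  apply/measurable_EFinP; apply: (measurableT_comp mPsi).
  by apply: (measurable_ml_eval (z := sample y)) => i j; exact: my.
rewrite /expectation_gap EX EY -EFinB abse_EFin lee_fin.
have -> : 2 * B / r`!%:R * D%:R * eta ^- (r * D) * tau `^ (r%:R / 2 - 1) =
  2 * B / r`!%:R * eta ^- (r * D) * (D%:R * tau `^ (r%:R / 2 - 1)) by ring.
exact: h.
Qed.

End Invariance.

(** * Ensembles *)

Section Orthonormal.
Context {R : realType} {d : measure_display} {T : measurableType d} {P : probability T R}.
Context {n : nat} {m : 'I_n -> nat}.
Variable X : ensembles P m.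
Arguments X : clear implicits.
Hypothesis X_ens : ensemble_sequence X.

Let x : forall i : 'I_n, 'I_(m i).+1 -> T -> R := fun i j => X i j.
Arguments x : clear implicits.

Lemma ens_measurable : measurable_family x.
Proof. by move=> i j; exact: measurable_funPT. Qed.

Lemma ens_one i t : x i ord0 t = 1.
Proof. exact: (X_ens.1 i).1. Qed.

(** The diagonal moments give square integrability, and a product is dominated by the sum of the two
    squares. *)
Lemma ens_orthonormal i j j' :
  P.-integrable setT (EFin \o (fun t => x i j t * x i j' t)) /\
  \int[P]_t (x i j t * x i j' t) = (j == j')%:R.
Proof.
have E k l : (\int[P]_t (x i k t * x i l t)%:E = ((k == l)%:R)%:E)%E.
  by have := (X_ens.1 i).2 k l; rewrite unlock.
have mxx k l : measurable_fun setT (fun t => x i k t * x i l t).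
  by apply: measurable_funM; exact: ens_measurable.
have sq k : P.-integrable setT (EFin \o (fun t => x i k t * x i k t)).
  apply/integrableP; split; first exact/measurable_EFinP.
  under eq_integral do rewrite /= ger0_norm -?expr2 ?sqr_ge0// expr2.
  by rewrite E ltry.
split; last by rewrite /Rintegral E.
apply: (@integrable_bounded _ _ _ _ _ (fun t => x i j t * x i j t + x i j' t * x i j' t)) => //.
  exact: integrableDr.
move=> t; rewrite normrM -!expr2 -[_ ^+ 2 in X in _ <= X + _]real_normK ?num_real//.
rewrite -[_ ^+ 2 in X in _ <= _ + X]real_normK ?num_real//.
have := sqr_ge0 (`|x i j t| - `|x i j' t|).
have := mulr_ge0 (normr_ge0 (x i j t)) (normr_ge0 (x i j' t)).
move: `|_| `|_| => a b ab; rewrite sqrrB; lra.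
Qed.

Lemma coord_eval k q t : ml_supported [set k]%SET q ->
  ml_eval q (sample x t) = \sum_b q b * x k (b k) t.
Proof. by move=> qk; rewrite (ml_eval_coord _ qk)// => i; exact: ens_one. Qed.

Lemma coord_sqr k q : ml_supported [set k]%SET q ->
  P.-integrable setT (EFin \o (fun t => ml_eval q (sample x t) ^+ 2)) /\
  \int[P]_t (ml_eval q (sample x t) ^+ 2) = ml_norm2 q.
Proof.
move=> qk.
have E : (fun t => ml_eval q (sample x t) ^+ 2) =
    (fun t => \sum_b \sum_b' q b * q b' * (x k (b k) t * x k (b' k) t)).
  apply/funext => t; rewrite (coord_eval _ qk) expr2 mulr_suml; apply: eq_bigr => b _.
  by rewrite mulr_sumr; apply: eq_bigr => b' _; ring.
have i1 b b' : P.-integrable setT (EFin \o (fun t => q b * q b' * (x k (b k) t * x k (b' k) t))).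
  by apply: integrableZr; exact: (ens_orthonormal _ _).1.
have i2 b := Rintegral_sum (index_enum (multi_index m)) (i1 b).
have [i3 e3] := Rintegral_sum (index_enum (multi_index m)) (fun b => (i2 b).1).
rewrite E; split => //; rewrite e3; apply: eq_bigr => b _; rewrite (i2 b).2.
rewrite (eq_bigr (fun b' => q b * (q b' * (b k == b' k)%:R))) => [|b' _]; last first.
  rewrite RintegralZl//; last exact: (ens_orthonormal _ _).1.
  by rewrite (ens_orthonormal _ _).2 mulrA.
rewrite -mulr_sumr expr2; have [->|/qk qb] := eqVneq (q b) 0; first by rewrite !mul0r.
congr (_ * _); rewrite (bigD1 b)//= eqxx mulr1 big1 ?addr0// => b' b'b.
have [->|/qk qb'] := eqVneq (q b') 0; first by rewrite mul0r.
by rewrite -(mi_supp1_eq qb qb') eq_sym (negPf b'b) mulr0.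
Qed.

Lemma coord_mean k q : ml_supported [set k]%SET q ->
  P.-integrable setT (EFin \o (fun t => ml_eval q (sample x t))) /\
  \int[P]_t ml_eval q (sample x t) = q mi_zero.
Proof.
move=> qk.
have E : (fun t => ml_eval q (sample x t)) =
    (fun t => \sum_b q b * (x k (b k) t * x k ord0 t)).
  by apply/funext => t; rewrite (coord_eval _ qk); apply: eq_bigr => b _; rewrite ens_one mulr1.
have i1 b : P.-integrable setT (EFin \o (fun t => q b * (x k (b k) t * x k ord0 t))).
  by apply: integrableZr; exact: (ens_orthonormal _ _).1.
have [i2 e2] := Rintegral_sum (index_enum (multi_index m)) i1.
rewrite E; split => //; rewrite e2 (bigD1 mi_zero)//= big1 ?addr0 => [|b b0].
  rewrite RintegralZl//; last exact: (ens_orthonormal _ _).1.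
  by rewrite (ens_orthonormal _ _).2 ffunE eqxx mulr1.
have [->|/qk qb] := eqVneq (q b) 0.
  by under eq_Rintegral do rewrite mul0r; rewrite Rintegral_cst// mul0r.
rewrite RintegralZl//; last exact: (ens_orthonormal _ _).1.
rewrite (ens_orthonormal _ _).2; move: b0; rewrite (mi_supp1_eq qb).
  by rewrite ffunE => /negPf ->; rewrite mulr0.
by apply/mi_suppP => i _; rewrite ffunE.
Qed.

(** Parseval's identity at each coordinate, tensorized; the inequality is enough to convert the L2
    norm in hypercontractivity into the coefficient norm. *)
Lemma moment_bound_l2 : moment_bound P x 2 1 [set: 'I_n]%SET.
Proof.
apply: (moment_bound_tensor ens_measurable X_ens.2 ens_one) => // k q qk.
rewrite ml_noise1; have [iq eq] := coord_sqr qk.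
rewrite sqr_sqrtr ?ml_norm2_ge0// -eq /Rintegral fineK; last exact: integrable_fin_num iq.
by under [X in (X <= _)%E]eq_integral do rewrite real_normK ?num_real//.
Qed.

Lemma moment_bound_hypercontractive r eta : (2 <= r)%N -> hypercontractive 2 r%:R eta X ->
  moment_bound P x r eta [set: 'I_n]%SET.
Proof.
move=> r2 [_ _ hyp] Q QT.
have r0 : r%:R != 0 :> R by rewrite pnatr_eq0 -lt0n ltnW.
have pow f (k : nat) : k%:R != 0 :> R ->
    (\int[P]_t (`|f t| ^+ k)%:E = 'N[P]_(k%:R%:E)[EFin \o f] `^ k%:R)%E.
  move=> k0; rewrite poweR_Lnorm//; apply: eq_integral => t _ /=.
  by rewrite powR_mulrn.
have mono (c : R) (u v : \bar R) : 0 <= c -> (0 <= u)%E -> (u <= v)%E -> (u `^ c <= v `^ c)%E.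
  move=> c0 u0 uv; apply: gt0_ler_poweR => //; rewrite in_itv /= leey andbT//.
  exact: le_trans uv.
have h2 : ('N[P]_2%:E[EFin \o ml_subst Q X] <= (Num.sqrt (ml_norm2 Q))%:E)%E.
  have := moment_bound_l2 QT; rewrite ml_noise1 pow ?pnatr_eq0// => h.
  have i0 : 0 <= 2^-1 :> R by rewrite invr_ge0.
  have := mono _ _ _ i0 (poweR_ge0 _ _) h; rewrite -poweRrM mulfV ?pnatr_eq0// poweRe1 ?Lnorm_ge0//.
  by rewrite poweR_EFin powR12_sqrt ?sqr_ge0// sqrtr_sqr ger0_norm ?sqrtr_ge0.
rewrite pow//; apply: (le_trans (mono _ _ _ (ler0n _ _) (Lnorm_ge0 _ _ _) (le_trans (hyp Q) h2))).
by rewrite poweR_EFin powR_mulrn ?sqrtr_ge0.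
Qed.

End Orthonormal.

(** By symmetry a >= 0. If a + v >= 0 only v^3 <= |v|^3 is used; otherwise the gap contains 2a^3 +
    6a^2 v + 6a v^2, which is [a] times a sum of squares. The term linear in [v] disappears on
    averaging. *)
Lemma cubic_le (R : realFieldType) (a v : R) :
  `|a + v| ^+ 3 <= `|a| ^+ 3 + 3 * (`|a| * a) * v + 3 * `|a| * v ^+ 2 + `|v| ^+ 3.
Proof.
wlog a0 : a v / 0 <= a => [h|].
  have [/h//|a0] := leP 0 a.
  have := h (- a) (- v); rewrite oppr_ge0 (ltW a0) -opprD !normrN sqrrN.
  by rewrite (_ : 3 * (`|a| * - a) * - v = 3 * (`|a| * a) * v); [apply|ring].
rewrite [`|a|]ger0_norm//.
have v3 : v ^+ 3 <= `|v| ^+ 3 by rewrite -normrX ler_norm.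
have nv3 : - v ^+ 3 <= `|v| ^+ 3 by rewrite -normrX -normrN ler_norm.
have [av|av] := leP 0 (a + v).
  rewrite ger0_norm//; have -> : (a + v) ^+ 3 = a ^+ 3 + 3 * (a * a) * v + 3 * a * v ^+ 2 + v ^+ 3 by ring.
  by rewrite lerD2l.
rewrite ltr0_norm//.
have h : 0 <= a * (2 * (a + 3 / 2 * v) ^+ 2 + 3 / 2 * v ^+ 2).
  by rewrite mulr_ge0// addr_ge0// mulr_ge0 ?sqr_ge0// divr_ge0.
have -> : (- (a + v)) ^+ 3 = - a ^+ 3 - 3 * (a * a) * v - 3 * a * v ^+ 2 - v ^+ 3 by ring.
have : 2 * a ^+ 3 + 6 * (a * a) * v + 6 * a * v ^+ 2 = a * (2 * (a + 3 / 2 * v) ^+ 2 + 3 / 2 * v ^+ 2) by field.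
lra.
Qed.

(** The constants come from eta <= 1/2: 3 eta^2 <= 3/4, and eta^3 K <= 1/2. Both [a] and 3a/4 + b/2
    are at most the square root [s]; they are weighted by a^2 and b^2. *)
Lemma cubic_sqrt_le (R : rcfType) (a b : R) : 0 <= a -> 0 <= b ->
  a ^+ 3 + 3 / 4 * a * b ^+ 2 + b ^+ 3 / 2 <= Num.sqrt (a ^+ 2 + b ^+ 2) ^+ 3.
Proof.
move=> a0 b0; set s := Num.sqrt _.
have s0 : 0 <= s by exact: sqrtr_ge0.
have s2 : s ^+ 2 = a ^+ 2 + b ^+ 2 by rewrite sqr_sqrtr// addr_ge0 ?sqr_ge0.
have sa : a <= s by rewrite -(@ler_pXn2r _ 2) ?nnegrE// s2 lerDl sqr_ge0.
have sab : 3 / 4 * a + b / 2 <= s.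
  rewrite -(@ler_pXn2r _ 2) ?nnegrE//; last by rewrite addr_ge0 ?mulr_ge0// divr_ge0.
  rewrite s2; have := sqr_ge0 (a - b); have := sqr_ge0 a; have := sqr_ge0 b; nra.
have h1 : a ^+ 2 * a <= a ^+ 2 * s by rewrite ler_wpM2l ?sqr_ge0.
have h2 : b ^+ 2 * (3 / 4 * a + b / 2) <= b ^+ 2 * s by rewrite ler_wpM2l ?sqr_ge0.
have -> : s ^+ 3 = a ^+ 2 * s + b ^+ 2 * s by rewrite -mulrDl -s2 -exprSr.
have -> : a ^+ 3 + 3 / 4 * a * b ^+ 2 + b ^+ 3 / 2 = a ^+ 2 * a + b ^+ 2 * (3 / 4 * a + b / 2) by field.
exact: lerD.
Qed.

(** * Moment bounds for a single coordinate *)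

Section OneCoordinate.
Context {R : realType} {n : nat} {m : 'I_n -> nat}.

Lemma mi_size_zero : mi_size (mi_zero : multi_index m) = 0%N.
Proof.
rewrite mi_sizeE; apply/eqP; rewrite cards_eq0 -finset.subset0.
by apply/mi_suppP => i _; rewrite ffunE.
Qed.

Lemma ml_noise_coord_part k (eta : R) (q : mlpoly R m) w : (forall i, w i ord0 = 1) ->
  ml_supported [set k]%SET q ->
  ml_eval (ml_noise eta q) w = q mi_zero + eta * ml_eval (ml_coord_part k q) w.
Proof.
move=> w1 qk; rewrite (ml_eval_coord_part (k := k) w1); last first.
  by move=> s; rewrite ffunE mulf_eq0 negb_or => /andP[_ /qk].
congr (_ + _); first by rewrite ffunE mi_size_zero mul1r.
rewrite /ml_eval mulr_sumr; apply: eq_bigr => s _; rewrite !ffunE.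
case: ifPn => sk; first by rewrite !mul0r mulr0.
have [->|/qk qs] := eqVneq (q s) 0; first by rewrite mulr0 mul0r mulr0.
have -> : mi_size s = 1%N.
  rewrite mi_sizeE (_ : mi_supp s = [set k]%SET) ?cards1//.
  by apply/eqP; rewrite finset.eqEsubset qs finset.sub1set inE.
by rewrite expr1 mulrA.
Qed.

Lemma ml_norm2_coord_part k (q : mlpoly R m) : ml_supported [set k]%SET q ->
  ml_norm2 q = q mi_zero ^+ 2 + ml_norm2 (ml_coord_part k q).
Proof.
move=> qk; rewrite /ml_norm2 (bigD1 mi_zero)//=; congr (_ + _).
rewrite [RHS](bigD1 mi_zero)//= !ffunE eqxx expr0n/= add0r.
apply: eq_bigr => s s0; rewrite ffunE; case: eqP => // sk.
have [->//|/qk hs] := eqVneq (q s) 0.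
move: s0; rewrite (mi_supp1_eq hs); first by rewrite ffunE sk eqxx.
by apply/mi_suppP => i _; rewrite ffunE.
Qed.

Context {d : measure_display} {T : measurableType d} {P : probability T R}.
Variable X : ensembles P m.
Arguments X : clear implicits.
Hypothesis X_ens : ensemble_sequence X.

Let x : forall i : 'I_n, 'I_(m i).+1 -> T -> R := fun i j => X i j.
Arguments x : clear implicits.

Let eval_measurable (q : mlpoly R m) : measurable_fun setT (fun t => ml_eval q (sample x t)).
Proof. by apply: measurable_ml_eval => i j; exact: ens_measurable. Qed.

(** [K] compares the third absolute moment of a mean-zero polynomial with the cube of its norm: it
    will be beta under H2 and alpha^(-1/2) under H3. *)
Lemma moment_bound_coord3 k (eta K : R) : 0 <= eta <= 2^-1 -> eta ^+ 3 * K <= 2^-1 ->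
  (forall v, ml_supported [set k]%SET v -> v mi_zero = 0 ->
    (\int[P]_t (`|ml_eval v (sample x t)| ^+ 3)%:E
       <= (K * Num.sqrt (ml_norm2 v) ^+ 3)%:E)%E) ->
  moment_bound P x 3 eta [set k]%SET.
Proof.
move=> /andP[eta0 eta12] etaK hK q qk; set v := ml_coord_part k q; set a := q mi_zero.
have vk : ml_supported [set k]%SET v by exact: ml_coord_part_supported.
have v0 : v mi_zero = 0 by rewrite !ffunE eqxx.
set b := Num.sqrt (ml_norm2 v); have b0 : 0 <= b by exact: sqrtr_ge0.
pose V t := ml_eval v (sample x t).
have [iV eV] := coord_mean X_ens vk; rewrite v0 in eV.
have [iV2 eV2] := coord_sqr X_ens vk.
have iV3 : P.-integrable setT (EFin \o (fun t => `|V t| ^+ 3)).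
  apply/integrableP; split.
    by apply/measurable_EFinP; apply: measurable_funX; exact: (measurableT_comp (@normr_measurable R setT) (eval_measurable _)).
  under eq_integral do rewrite /= ger0_norm ?exprn_ge0//.
  by rewrite (le_lt_trans (hK v vk v0))// ltry.
have eV3 : \int[P]_t (`|V t| ^+ 3) <= K * b ^+ 3.
  by rewrite -lee_fin /Rintegral fineK ?hK//; exact: integrable_fin_num iV3.
have -> : ml_norm2 q = `|a| ^+ 2 + b ^+ 2.
  by rewrite (ml_norm2_coord_part qk) real_normK ?num_real// sqr_sqrtr ?ml_norm2_ge0.
pose F t := `|a| ^+ 3 + (3 * (`|a| * a) * eta * V t +
   (3 * `|a| * eta ^+ 2 * V t ^+ 2 + eta ^+ 3 * `|V t| ^+ 3)).
have i34 : P.-integrable setT (EFin \o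
    (fun t => 3 * `|a| * eta ^+ 2 * V t ^+ 2 + eta ^+ 3 * `|V t| ^+ 3)).
  by apply: integrableDr; exact: integrableZr.
have i234 : P.-integrable setT (EFin \o (fun t => 3 * (`|a| * a) * eta * V t +
   (3 * `|a| * eta ^+ 2 * V t ^+ 2 + eta ^+ 3 * `|V t| ^+ 3))).
  by apply: integrableDr => //; exact: integrableZr.
have iF : P.-integrable setT (EFin \o F).
  by apply: integrableDr => //; exact: integrable_constr.
have mL : measurable_fun setT (fun t => `|ml_eval (ml_noise eta q) (sample x t)| ^+ 3).
  by apply: measurable_funX; exact: (measurableT_comp (@normr_measurable R setT) (eval_measurable _)).
apply: (@le_trans _ _ (\int[P]_t (F t)%:E)%E).
  apply: ge0_le_integral => //.
  - exact/measurable_EFinP.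
  - by have /integrableP[] := iF.
  - move=> t _; rewrite lee_fin (ml_noise_coord_part eta _ qk); last by move=> i; exact: ens_one.
    rewrite (le_trans (cubic_le _ _))// -/a -/v -/(V t) /F normrM (ger0_norm eta0) !exprMn.
    by rewrite !addrA !mulrA.
rewrite -[leLHS]fineK; last exact: integrable_fin_num iF.
rewrite -[fine _]/(Rintegral P setT F) lee_fin /F.
rewrite !RintegralD//; do ?[exact: integrableZr | exact: integrable_constr].
rewrite Rintegral_cst// !RintegralZl// eV eV2 mulr0 add0r.
have -> : fine (P setT) = 1 by rewrite probability_setT.
rewrite mulr1 (le_trans _ (cubic_sqrt_le (normr_ge0 a) b0))// -addrA lerD2l lerD//.
  rewrite -[ml_norm2 v]sqr_sqrtr ?ml_norm2_ge0// -/b ler_wpM2r ?sqr_ge0//.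
  rewrite mulrAC ler_wpM2r//.
  have : eta * eta <= 2^-1 * 2^-1 by apply: ler_pM.
  by rewrite expr2; lra.
rewrite (le_trans (ler_wpM2l _ eV3)) ?exprn_ge0// mulrA mulrC ler_wpM2l ?exprn_ge0//.
Qed.

(** With eta^2 = 1/3 the quadratic term 6 a^2 eta^2 E V^2 is 2 a^2 E V^2 and eta^4 = 1/9 cancels the
    constant 9; the sum is then at most (a^2 + E V^2)^2, with both odd terms zero. *)
Lemma moment_bound_coord4 k (eta : R) : eta ^+ 2 = 3^-1 ->
  (forall v, ml_supported [set k]%SET v -> v mi_zero = 0 ->
    [/\ (\int[P]_t (`|ml_eval v (sample x t)| ^+ 4)%:E <= (9 * ml_norm2 v ^+ 2)%:E)%E &
        \int[P]_t (ml_eval v (sample x t) ^+ 3) = 0]) ->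
  moment_bound P x 4 eta [set k]%SET.
Proof.
move=> eta2 hV q qk; set v := ml_coord_part k q; set a := q mi_zero.
have vk : ml_supported [set k]%SET v by exact: ml_coord_part_supported.
have v0 : v mi_zero = 0 by rewrite !ffunE eqxx.
pose V t := ml_eval v (sample x t).
have [iV eV] := coord_mean X_ens vk; rewrite v0 in eV.
have [iV2 eV2] := coord_sqr X_ens vk.
have [hV4 eV3] := hV v vk v0.
have iV4 : P.-integrable setT (EFin \o (fun t => `|V t| ^+ 4)).
  apply/integrableP; split.
    by apply/measurable_EFinP; apply: measurable_funX; exact: (measurableT_comp (@normr_measurable R setT) (eval_measurable _)).
  under eq_integral do rewrite /= ger0_norm ?exprn_ge0//.
  by rewrite (le_lt_trans hV4)// ltry.
have eV4 : \int[P]_t (`|V t| ^+ 4) <= 9 * ml_norm2 v ^+ 2.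
  by rewrite -lee_fin /Rintegral fineK ?hV4//; exact: integrable_fin_num iV4.
have iV3 : P.-integrable setT (EFin \o (fun t => V t ^+ 3)).
  by apply: (integrable_exp3 (eval_measurable v)); rewrite (le_lt_trans hV4)// ltry.
pose c := a ^+ 4.
pose F t := c + (4 * a ^+ 3 * eta * V t + (2 * a ^+ 2 * V t ^+ 2 +
   (4 * a * eta ^+ 3 * V t ^+ 3 + 9^-1 * `|V t| ^+ 4))).
have i45 : P.-integrable setT (EFin \o (fun t => 4 * a * eta ^+ 3 * V t ^+ 3 + 9^-1 * `|V t| ^+ 4)).
  by apply: integrableDr; exact: integrableZr.
have i345 : P.-integrable setT (EFin \o (fun t => 2 * a ^+ 2 * V t ^+ 2 +
   (4 * a * eta ^+ 3 * V t ^+ 3 + 9^-1 * `|V t| ^+ 4))).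
  by apply: integrableDr => //; exact: integrableZr.
have i2345 : P.-integrable setT (EFin \o (fun t => 4 * a ^+ 3 * eta * V t + (2 * a ^+ 2 * V t ^+ 2 +
   (4 * a * eta ^+ 3 * V t ^+ 3 + 9^-1 * `|V t| ^+ 4)))).
  by apply: integrableDr => //; exact: integrableZr.
have iF : P.-integrable setT (EFin \o F).
  by apply: integrableDr => //; exact: integrable_constr.
have even4 (u : R) : `|u| ^+ 4 = u ^+ 4 by rewrite (exprM _ 2 2) real_normK ?num_real// -exprM.
have EF t : `|ml_eval (ml_noise eta q) (sample x t)| ^+ 4 = F t.
  rewrite (ml_noise_coord_part eta _ qk); last by move=> i; exact: ens_one.
  rewrite even4 -/a -/v -/(V t) /F /c even4.
  have -> : (a + eta * V t) ^+ 4 = a ^+ 4 + (4 * a ^+ 3 * eta * V t + (6 * a ^+ 2 * eta ^+ 2 * V t ^+ 2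
    + (4 * a * eta ^+ 3 * V t ^+ 3 + (eta ^+ 2) ^+ 2 * V t ^+ 4))) by ring.
  by rewrite eta2; congr (_ + (_ + (_ + (_ + _)))); field.
under eq_integral do rewrite EF.
rewrite -[leLHS]fineK; last exact: integrable_fin_num iF.
rewrite -[fine _]/(Rintegral P setT F) lee_fin /F.
rewrite !RintegralD//; do ?[exact: integrableZr | exact: integrable_constr].
rewrite Rintegral_cst// !RintegralZl// eV eV2 eV3 !mulr0 !add0r.
have -> : fine (P setT) = 1 by rewrite probability_setT.
rewrite mulr1 (exprM _ 2 2) sqr_sqrtr ?ml_norm2_ge0// (ml_norm2_coord_part qk) -/a -/v.
have : 9^-1 * (\int[P]_t (`|V t| ^+ 4)) <= 9^-1 * (9 * ml_norm2 v ^+ 2) by rewrite ler_wpM2l.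
rewrite mulrA mulVf ?mul1r ?pnatr_eq0// => h.
have -> : (a ^+ 2 + ml_norm2 v) ^+ 2 = c + (2 * a ^+ 2 * ml_norm2 v + ml_norm2 v ^+ 2).
  by rewrite /c; ring.
by rewrite !lerD2l.
Qed.

End OneCoordinate.

(** * Moments of symmetric laws *)

Section SymmetricLaws.
Context {R : realType}.
Local Notation leb := (@lebesgue_measure R).

Let mopp : measurable_fun setT (-%R : measurableTypeR R -> measurableTypeR R).
Proof. exact: oppr_measurable. Qed.

Let leb_opp : {measure set (measurableTypeR R) -> \bar R} := ltac:(
  unshelve refine (pushforward leb (-%R : measurableTypeR R -> measurableTypeR R)); exact: mopp).

(** Uniqueness of Lebesgue measure on half-open intervals; reflection moves the closed end, which
    does not change the length. *)
Lemma lebesgue_measure_opp (A : set R) : measurable A -> leb (-%R @^-1` A) = leb A.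
Proof.
move=> mA; apply/esym; rewrite -[RHS]/(leb_opp A).
apply: lebesgue_measure_unique mA => _ [[a b] _ <-] /=.
rewrite /pushforward lebesgue_measure_itv.
have -> : -%R @^-1` `]a, b] = [set` `[- b, - a[].
  by apply/seteqP; split=> t /=; rewrite !in_itv /= => /andP[h1 h2]; apply/andP; split;
    rewrite 1?lerNl 1?ltrNr// 1?lerNr 1?ltrNl.
rewrite lebesgue_measure_itv /= !lte_fin ltrN2; case: ifP => // _.
by rewrite -!EFinB opprK addrC.
Qed.

Lemma integral_even_opp (p : R -> R) (A : set R) : measurable_fun setT p ->
  (forall u, 0 <= p u) -> (forall u, p (- u) = p u) -> measurable A ->
  (\int[leb]_(u in -%R @^-1` A) (p u)%:E = \int[leb]_(u in A) (p u)%:E)%E.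
Proof.
move=> mp p0 pe mA.
have -> : (\int[leb]_(u in A) (p u)%:E = \int[leb_opp]_(u in A) (p u)%:E)%E.
  by apply: eq_measure_integral => B mB _; exact/esym/lebesgue_measure_opp.
rewrite ge0_integral_pushforward//.
- by apply: eq_integral => u _ /=; rewrite pe.
- by apply/measurable_funTS/measurable_EFinP.
- by move=> u _; rewrite lee_fin.
Qed.

Import HBNNSimple.

(** Indicators are the hypothesis, simple functions follow by linearity, and nonnegative functions
    by monotone convergence on both sides. *)
Lemma ge0_integral_density (nu : {measure set R -> \bar R}) (p : R -> R) (f : R -> \bar R) :
  measurable_fun setT p -> (forall u, 0 <= p u) ->
  (forall A, measurable A -> nu A = (\int[leb]_(u in A) (p u)%:E)%E) ->
  measurable_fun setT f -> (forall u, (0 <= f u)%E) ->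
  (\int[nu]_u f u = \int[leb]_u (f u * (p u)%:E))%E.
Proof.
move=> mp p0 nuE mf f0.
have mpE : measurable_fun setT (EFin \o p) by exact/measurable_EFinP.
pose h := nnsfun_approx measurableT mf.
have mh k : measurable_fun setT (fun u => (h k u)%:E) by exact/measurable_EFinP/measurable_funTS.
have approx u : (EFin \o h ^~ u) @ \oo --> f u by apply: cvg_nnsfun_approx => // *.
have nd u : {homo (fun k => (h k u)%:E) : i j / (i <= j)%N >-> (i <= j)%E}.
  by move=> i j ij; rewrite lee_fin; exact/lefP/nd_nnsfun_approx.
transitivity (limn (fun k => \int[nu]_u (h k u)%:E)%E).
  rewrite -monotone_convergence//.
  - by apply: eq_integral => u _; apply/esym/cvg_lim => //; exact: approx.
  - by move=> k u _; rewrite lee_fin.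
transitivity (limn (fun k => \int[leb]_u ((h k u)%:E * (p u)%:E))%E); last first.
  rewrite -monotone_convergence//.
  - apply: eq_integral => u _; apply/cvg_lim => //.
    by apply: cvgeZr => //; exact: approx.
  - move=> k; apply: emeasurable_funM; [exact: mh|exact: mpE].
  - by move=> k u _; rewrite mule_ge0 ?lee_fin.
  - by move=> u _ i j ij; rewrite lee_wpmul2r ?lee_fin//; exact: nd.
congr (limn _); apply/funext => k.
transitivity (\int[nu]_u (\sum_(y \in range (h k)) (y * \1_(h k @^-1` [set y]) u)%:E))%E.
  by apply: eq_integral => u _; rewrite /= fimfunE -fsumEFin.
have mind y : measurable_fun setT (fun u : R => (y * \1_(h k @^-1` [set y]) u)%:E).
  by apply/measurable_EFinP; apply: measurable_funM => //; apply: measurable_indic; exact: measurable_funPTI.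
rewrite ge0_integral_fsum//; last by move=> y u _; exact: nnfun_muleindic_ge0.
transitivity (\int[leb]_u (\sum_(y \in range (h k)) (y * \1_(h k @^-1` [set y]) u)%:E * (p u)%:E))%E;
    last first.
  apply: eq_integral => u _.
  rewrite -ge0_mule_fsuml => [|y]; last exact: nnfun_muleindic_ge0.
  by congr (_ * _)%E; rewrite /= fimfunE -fsumEFin.
rewrite ge0_integral_fsum//; last 2 first.
  - by move=> y; apply: emeasurable_funM; [exact: mind|exact: mpE].
  - by move=> y u _; apply: mule_ge0; [exact: nnfun_muleindic_ge0|rewrite lee_fin].
apply: eq_fsbigr => y; rewrite inE => -[t _ <-].
have mset : measurable (h k @^-1` [set h k t]) by exact: measurable_funPTI.
have ht : (0 <= (h k t)%:E)%E by rewrite lee_fin.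
transitivity ((h k t)%:E * \int[nu]_u (\1_(h k @^-1` [set h k t]) u)%:E)%E.
  under eq_integral do rewrite EFinM.
  rewrite ge0_integralZl//; first by apply/measurable_EFinP; exact: measurable_indic.
under [RHS]eq_integral do rewrite EFinM -muleA.
rewrite ge0_integralZl//.
- congr (_ * _)%E; rewrite integral_indic// setIT nuE//.
  rewrite [LHS]integral_mkcond; apply: eq_integral => u _.
  by rewrite epatch_indic muleC.
- by apply: emeasurable_funM; [apply/measurable_EFinP; exact: measurable_indic|exact: mpE].
- by move=> u _; apply: mule_ge0; rewrite lee_fin.
Qed.

End SymmetricLaws.

(** The left side is the Gaussian bound on E Z^4, as E exp(Z) = E exp(-Z) = e^(1/2) and E Z^2 = 1.
    From e^(-1/4) >= 3/4 follows e^(1/2) <= 16/9. *)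
Lemma expR_half_le (R : realType) : 12 * (expR 2^-1 + expR 2^-1) - (24 + 12) <= 9 :> R.
Proof.
suff : expR 2^-1 <= 16 / 9 :> R by lra.
have h : 3 / 4 <= expR (- 4^-1) :> R by rewrite (le_trans _ (expR_ge1Dx _))//; lra.
have -> : expR 2^-1 = (expR (- 4^-1))^-1 ^+ 2 :> R.
  by rewrite -expRN opprK expr2 -expRD; congr expR; lra.
have -> : 16 / 9 = (3 / 4)^-1 ^+ 2 :> R by field.
rewrite lerXn2r ?nnegrE ?invr_ge0 ?expR_ge0 ?divr_ge0//.
by rewrite lef_pV2 ?posrE ?expR_gt0 ?divr_gt0.
Qed.

(** Truncation of the series of 2 cosh u, multiplied by 12. In the sum of the two exponential series
    odd terms cancel and even ones are nonnegative, so the five terms up to u^4 are a lower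
    bound. *)
Lemma cosh_ge (R : realType) (u : R) :
  u ^+ 4 + (24 + 12 * u ^+ 2) <= 12 * (expR u + expR (- u)).
Proof.
suff : 2 + u ^+ 2 + u ^+ 4 / 12 <= expR u + expR (- u) by lra.
pose s k : R := series (exp_coeff u) k + series (exp_coeff (- u)) k.
have cs : s @ \oo --> expR u + expR (- u).
  by apply: cvgD; exact: is_cvg_series_exp_coeff.
have nds : nondecreasing_seq s.
  apply/nondecreasing_seqP => k; rewrite /s !seriesSr addrACA lerDl /exp_coeff /=.
  rewrite exprNn -mulrDl divr_ge0// -signr_odd; case: (boolP (odd k)) => ok /=.
    by rewrite expr1 mulN1r subrr.
  by rewrite expr0 mul1r addr_ge0 ?exprn_even_ge0.
have := nondecreasing_cvgn_le nds (cvgP _ cs) 5; rewrite (cvg_lim _ cs)//; apply: le_trans.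
rewrite /s !seriesEnat /= !big_nat_recr//= !big_nil /exp_coeff /= !factS fact0 !expr0 !expr1.
by rewrite le_eqVlt; apply/orP; left; apply/eqP; field.
Qed.

Section Laws.
Context {R : realType} {d : measure_display} {T : measurableType d} {P : probability T R}.
Variable Z : {RV P >-> R}.

Lemma symmetric_third_moment :
  (forall A : set R, measurable A -> distribution P Z (-%R @^-1` A) = distribution P Z A) ->
  P.-integrable setT (EFin \o (fun t => Z t ^+ 3)) -> \int[P]_t (Z t ^+ 3) = 0.
Proof.
move=> sym i3.
have mZ : measurable_fun setT Z by exact: measurable_funPT.
have mNZ : measurable_fun setT (fun t => - Z t) by exact: measurableT_comp.
have m3 : measurable_fun setT (fun u : R => (u ^+ 3)%:E).
  by apply/measurable_EFinP; exact: measurable_funX.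
have iN3 : P.-integrable setT ((fun u : R => (u ^+ 3)%:E) \o (fun t => - Z t)).
  have := integrableZr (-1) i3; apply: eq_integrable => // t _ /=.
  by rewrite exprNn -signr_odd expr1 mulN1r.
have E : (\int[P]_t (Z t ^+ 3)%:E = \int[P]_t ((- Z t) ^+ 3)%:E)%E.
  transitivity (\int[distribution P Z]_u (u ^+ 3)%:E)%E.
    by rewrite integral_distribution.
  apply: etrans (integral_pushforward mNZ m3 iN3 measurableT).
  by apply: eq_measure_integral => A mA _; exact/esym/(sym _ mA).
have : \int[P]_t (Z t ^+ 3) = \int[P]_t (- 1 * Z t ^+ 3).
  rewrite {1}/Rintegral E; congr fine; apply: eq_integral => t _.
  by rewrite exprNn -signr_odd.
rewrite RintegralZl//; lra.
Qed.

Hypotheses (Z_mean : \int[P]_t Z t = 0).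
Hypotheses (Z2_int : P.-integrable setT (EFin \o (fun t => Z t ^+ 2))) (Z_var : \int[P]_t (Z t ^+ 2) = 1).

Let mZ : measurable_fun setT Z. Proof. exact: measurable_funPT. Qed.

Let mZ4 : measurable_fun setT (fun t => (`|Z t| ^+ 4)%:E).
Proof. by apply/measurable_EFinP; apply: measurable_funX; exact: (measurableT_comp (@normr_measurable R setT)). Qed.

Let EZ2 : (\int[P]_t (Z t ^+ 2)%:E = 1)%E.
Proof. by rewrite -[LHS]fineK; [rewrite -[fine _]/(Rintegral P setT _) Z_var|exact: integrable_fin_num Z2_int]. Qed.

Lemma bounded_fourth_moment (c : R) : 0 <= c -> {ae P, forall t, Z t ^+ 2 <= c} ->
  (\int[P]_t (`|Z t| ^+ 4)%:E <= c%:E)%E.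
Proof.
move=> c0 hc.
apply: (@le_trans _ _ (\int[P]_t (c%:E * (Z t ^+ 2)%:E))%E).
  apply: ae_ge0_le_integral => //.
  - by move=> t _; rewrite mule_ge0// lee_fin// sqr_ge0.
  - by apply: measurable_funeM; apply/measurable_EFinP; exact: measurable_funX.
  - apply: filterS hc => t h _; rewrite -EFinM lee_fin (exprM _ 2 2) real_normK ?num_real//.
    by rewrite expr2 ler_wpM2r ?sqr_ge0.
rewrite ge0_integralZl//.
- by rewrite EZ2 mule1.
- by apply/measurable_EFinP; exact: measurable_funX.
- by move=> t _; rewrite lee_fin sqr_ge0.
Qed.

Lemma uniform_bit_moments : uniform_bit Z ->
  (\int[P]_t (`|Z t| ^+ 4)%:E <= 9%:E)%E /\ \int[P]_t (Z t ^+ 3) = 0.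
Proof.
move=> [h1 h2].
have m1 (u : R) : measurable (Z @^-1` [set u]) by exact: measurable_funPTI.
(* The two values already carry total mass 1, so Z^2 = 1 almost surely and Z^3 = Z there. *)
have PN : P (~` (Z @^-1` [set 1] `|` Z @^-1` [set -1])) = 0.
  rewrite probability_setC; last exact: measurableU.
  rewrite measureU//.
    have e : 2^-1 + 2^-1 = 1 :> R by lra.
    by rewrite /= h1 h2 -EFinD e subrr.
  by apply/seteqP; split=> // t [/= e1 e2]; move: e2; rewrite e1 => /eqP; rewrite -subr_eq0 opprK (@pnatr_eq0 R 2).
have ae1 : {ae P, forall t, Z t ^+ 2 = 1}.
  exists (~` (Z @^-1` [set 1] `|` Z @^-1` [set -1])); split; [|exact: PN|].
    by apply: measurableC; exact: measurableU.
  by move=> t; apply: contra_not => -[/= ->|/= ->]; rewrite ?sqrrN expr1n.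
have h4 : (\int[P]_t (`|Z t| ^+ 4)%:E <= 9%:E)%E.
  by apply: bounded_fourth_moment => //; apply: filterS ae1 => t ->; rewrite ler1n.
split => //; rewrite -Z_mean /Rintegral; congr fine; apply: ae_eq_integral => //.
- by apply/measurable_EFinP; exact: measurable_funX.
- exact/measurable_EFinP.
- by apply: filterS ae1 => t h _ /=; rewrite exprSr h mul1r.
Qed.

Lemma uniform_sqrt3_moments : uniform_sqrt3 Z ->
  (\int[P]_t (`|Z t| ^+ 4)%:E <= 9%:E)%E /\ \int[P]_t (Z t ^+ 3) = 0.
Proof.
move=> hZ.
have mpdf := measurable_uniform_pdf (- Num.sqrt 3 : R) (Num.sqrt 3).
have ae1 : {ae P, forall t, Z t ^+ 2 <= 3}.
  exists (Z @^-1` (~` `[- Num.sqrt 3, Num.sqrt 3])); split.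
  - by apply: measurable_funPTI; exact: measurableC.
  - rewrite -[LHS]/(distribution P Z _) hZ; last exact: measurableC.
    by rewrite /uniform_prob integral_uniform_pdf setICl integral_set0.
  - move=> t; apply: contra_not => /=; rewrite in_itv /= -ler_norml => h.
    have s3 : Num.sqrt 3 ^+ 2 = 3 :> R by rewrite sqr_sqrtr.
    by rewrite -real_normK ?num_real// -s3; apply: lerXn2r; rewrite ?nnegrE ?sqrtr_ge0.
have h4 : (\int[P]_t (`|Z t| ^+ 4)%:E <= 9%:E)%E.
  by apply: bounded_fourth_moment => //; apply: filterS ae1 => t /le_trans; apply; rewrite ler_nat.
split => //; apply: symmetric_third_moment; last by apply: (integrable_exp3 mZ); rewrite (le_lt_trans h4)// ltry.
move=> A mA; rewrite !hZ//; last by rewrite -[X in measurable X]setTI; exact: oppr_measurable.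
apply: (@integral_even_opp R (uniform_pdf (- Num.sqrt 3) (Num.sqrt 3))) => //.
- by move=> u; apply: uniform_pdf_ge0; exact: sqrt3_interval.
- by move=> u; rewrite /uniform_pdf lerN2 [in - u <= _]lerNl andbC.
Qed.

(* The fourth moment is bounded through [cosh_ge] and the moment generating function at 1 and -1. *)
Lemma standard_gaussian_moments : standard_gaussian Z ->
  (\int[P]_t (`|Z t| ^+ 4)%:E <= 9%:E)%E /\ \int[P]_t (Z t ^+ 3) = 0.
Proof.
move=> hZ.
have mpdf := @measurable_normal_pdf R 0 1.
have pdf0 (u : R) : 0 <= normal_pdf 0 1 u by exact: normal_pdf_ge0.
have mgf (c : R) : c ^+ 2 = 1 -> (\int[P]_t (expR (c * Z t))%:E = (expR 2^-1)%:E)%E.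
  move=> c2.
  have me : measurable_fun setT (fun u : R => (expR (c * u))%:E).
    by apply/measurable_EFinP; apply: measurableT_comp => //; exact: measurable_funM.
  transitivity (\int[distribution P Z]_u (expR (c * u))%:E)%E.
    by rewrite ge0_integral_distribution// => u; rewrite lee_fin expR_ge0.
  rewrite (ge0_integral_density mpdf pdf0 hZ me) => [|u]; last by rewrite lee_fin expR_ge0.
  (* Completing the square: exp(cu) times the standard density is e^(1/2) times the density of mean
     [c], as c^2 = 1. *)
  transitivity (\int[@lebesgue_measure R]_u ((expR 2^-1)%:E * (normal_pdf c 1 u)%:E))%E.
    apply: eq_integral => u _; rewrite -!EFinM; congr EFin.
    rewrite !normal_pdfE ?oner_neq0// /normal_fun mulrCA [RHS]mulrCA; congr (_ * _).
    by rewrite -!expRD; congr expR; rewrite subr0 expr1n sqrrB c2; field.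
  rewrite ge0_integralZl//.
  - by rewrite integral_normal_pdf mule1.
  - by apply/measurable_EFinP; exact: measurable_normal_pdf.
  - by move=> u _; rewrite lee_fin normal_pdf_ge0.
have mexp (c : R) : measurable_fun setT (fun t => (expR (c * Z t))%:E).
  by apply/measurable_EFinP; apply: measurableT_comp => //; exact: measurable_funM.
have e12 := expR_half_le R.
have h4 : (\int[P]_t (`|Z t| ^+ 4)%:E <= 9%:E)%E.
  (* The terms 24 + 12 Z^2 stay on the left so that all integrands are nonnegative and additivity
     holds before E Z^4 is known to be finite. *)
  have : (\int[P]_t ((`|Z t| ^+ 4)%:E + (24%:E + 12%:E * (Z t ^+ 2)%:E)) <=
          \int[P]_t (12%:E * ((expR (1 * Z t))%:E + (expR (- 1 * Z t))%:E)))%E.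
    apply: ge0_le_integral => //.
    - by move=> t _; rewrite !adde_ge0 ?mule_ge0 ?lee_fin ?sqr_ge0 ?exprn_ge0.
    - apply: emeasurable_funD => //; apply: emeasurable_funD => //; apply: measurable_funeM.
      by apply/measurable_EFinP; exact: measurable_funX.
    - by apply: measurable_funeM; exact: emeasurable_funD.
    - move=> t _; rewrite -EFinM -!EFinD -EFinM lee_fin mul1r mulN1r.
      rewrite (exprM _ 2 2) real_normK ?num_real// -exprM.
      exact: cosh_ge.
  have mZ2 : measurable_fun setT (fun t => (Z t ^+ 2)%:E).
    by apply/measurable_EFinP; exact: measurable_funX.
  have n4 t : (0 <= (`|Z t| ^+ 4)%:E)%E by rewrite lee_fin exprn_ge0.
  have n2 t : (0 <= (Z t ^+ 2)%:E)%E by rewrite lee_fin sqr_ge0.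
  have n12 t : (0 <= 12%:E * (Z t ^+ 2)%:E)%E by rewrite mule_ge0.
  have n24 t : (0 <= 24%:E + 12%:E * (Z t ^+ 2)%:E)%E by rewrite adde_ge0.
  have ne c t : (0 <= (expR (c * Z t))%:E)%E by rewrite lee_fin expR_ge0.
  have nee t : (0 <= (expR (1 * Z t))%:E + (expR (- 1 * Z t))%:E)%E by rewrite adde_ge0.
  have m12 : measurable_fun setT (fun t => 12%:E * (Z t ^+ 2)%:E)%E by exact: measurable_funeM.
  have m24 : measurable_fun setT (fun t => 24%:E + 12%:E * (Z t ^+ 2)%:E)%E.
    exact: emeasurable_funD.
  have mee : measurable_fun setT (fun t => (expR (1 * Z t))%:E + (expR (- 1 * Z t))%:E)%E.
    exact: emeasurable_funD.
  rewrite ge0_integralD// ge0_integralD// ge0_integralZl//.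
  rewrite ge0_integralZl// ge0_integralD//.
  rewrite EZ2 !mgf ?sqrrN ?expr1n// integral_cst//= probability_setT !mule1 -EFinD -EFinD -EFinM.
  have : (\int[P]_t (`|Z t| ^+ 4)%:E)%E != -oo%E.
    by rewrite gt_eqF// (lt_le_trans (ltNyr 0))// integral_ge0.
  case: (\int[P]_t (`|Z t| ^+ 4)%:E)%E => [v _| |]//=.
  by rewrite -EFinD !lee_fin -lerBrDr => /le_trans; apply.
split => //; apply: symmetric_third_moment; last by apply: (integrable_exp3 mZ); rewrite (le_lt_trans h4)// ltry.
move=> A mA; rewrite !hZ//; last by rewrite -[X in measurable X]setTI; exact: oppr_measurable.
apply: (@integral_even_opp R (normal_pdf 0 1)) => // u.
by rewrite !normal_pdfE ?oner_neq0// /normal_fun !subr0 sqrrN.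
Qed.

End Laws.

(** * Single-coordinate bounds for the concrete laws *)

Section TwoVariables.
Context {R : realType} {n : nat} {m : 'I_n -> nat}.

(** Only the constant and one further monomial live on coordinate [k]. The index [j] is quantified
    to avoid transport along [m k = 1]. *)
Lemma two_variables_eval k (v : mlpoly R m) : m k = 1%N ->
  ml_supported [set k]%SET v -> v mi_zero = 0 ->
  exists c (j : 'I_(m k).+1), [/\ j != ord0, ml_norm2 v = c ^+ 2 &
    forall w, (forall i, w i ord0 = 1) -> ml_eval v w = c * w k j].
Proof.
move=> mk vk v0.
pose j : 'I_(m k).+1 := ord_max.
pose top : multi_index m := [ffun i => ord_max].
pose b := mi_merge [set k]%SET top mi_zero.
have bk : b k = j by rewrite !ffunE !inE eqxx.
have bsupp : mi_supp b \subset [set k]%SET.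
  by apply/mi_suppP => i ik; rewrite !ffunE (negPf ik).
have j0 : j != ord0 by rewrite -val_eqE /= mk.
have vb s : s != b -> v s = 0.
  move=> sb; have [//|/[dup] vs /vk hs] := eqVneq (v s) 0.
  have sk0 : s k != ord0.
    apply: contra_neqN vs => /eqP sk; rewrite (_ : s = mi_zero)//.
    apply/eqP; rewrite (mi_supp1_eq hs); first by rewrite ffunE sk.
    by apply/mi_suppP => i _; rewrite ffunE.
  have sk1 : nat_of_ord (s k) != 1%N.
    by apply: contraNneq sb => sk1; rewrite (mi_supp1_eq hs bsupp) bk -val_eqE /= sk1 mk.
  have : (nat_of_ord (s k) <= 1)%N by rewrite -[leqRHS]mk -ltnS ltn_ord.
  by move: sk0 sk1; rewrite -val_eqE /=; case: (nat_of_ord (s k)) => [|[|]].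
exists (v b), j; split=> // [|w w1].
  by rewrite /ml_norm2 (bigD1 b)//= big1 ?addr0// => s sb; rewrite vb// expr0n.
rewrite (ml_eval_coord w1 vk) (bigD1 b)//= bk big1 ?addr0// => s sb.
by rewrite vb// mul0r.
Qed.

End TwoVariables.

Section OneCoordinateLaws.
Context {R : realType} {d : measure_display} {T : measurableType d} {P : probability T R}.
Context {n : nat} {m : 'I_n -> nat}.
Variable X : ensembles P m.
Arguments X : clear implicits.
Hypothesis X_ens : ensemble_sequence X.

Let x : forall i : 'I_n, 'I_(m i).+1 -> T -> R := fun i j => X i j.
Arguments x : clear implicits.

Lemma moment_bound_third_moment k (beta eta : R) :
  two_variable_ensembles (bounded_third_moment beta) X ->
  0 <= eta <= 2^-1 -> eta ^+ 3 * beta <= 2^-1 -> moment_bound P x 3 eta [set k]%SET.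
Proof.
move=> X2 heta hbeta; apply: (moment_bound_coord3 X_ens heta hbeta) => v vk v0.
have [mk Xk] := X2 k.
have [c [j [j0 -> hv]]] := two_variables_eval mk vk v0.
have [_ _] := Xk j j0; rewrite unlock => h3.
have E t : `|ml_eval v (sample x t)| ^+ 3 = `|c| ^+ 3 * `|X k j t| ^+ 3.
  by rewrite hv => [|i]; [rewrite normrM exprMn|exact: (ens_one X_ens)].
under eq_integral do rewrite E EFinM.
rewrite ge0_integralZl//.
- by rewrite sqrtr_sqr [beta * _]mulrC (EFinM (`|c| ^+ 3)) lee_wpmul2l ?lee_fin ?exprn_ge0.
- apply/measurable_EFinP; apply: measurable_funX.
  exact: (measurableT_comp (@normr_measurable R setT)).
Qed.

(** Integrating 3 z^2 <= 1 + 2 |z|^3 gives 3 <= 1 + 2 beta. This keeps [eta] below 1/2 under H2. *)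
Lemma bounded_third_moment_ge1 (beta : R) k :
  two_variable_ensembles (bounded_third_moment beta) X -> (0 < m k)%N -> 1 <= beta.
Proof.
move=> X2 mk; have [mk1 Xk] := X2 k.
pose j : 'I_(m k).+1 := ord_max.
have j0 : j != ord0 by rewrite -val_eqE /= mk1.
have [_ h2 h3] := Xk j j0; rewrite unlock in h2; rewrite unlock in h3.
have m3 : measurable_fun setT (fun t => (`|X k j t| ^+ 3)%:E).
  apply/measurable_EFinP; apply: measurable_funX.
  exact: (measurableT_comp (@normr_measurable R setT)).
have m2 : measurable_fun setT (fun t => (X k j t ^+ 2)%:E).
  by apply/measurable_EFinP; exact: measurable_funX.
have n3 t : (0 <= (`|X k j t| ^+ 3)%:E)%E by rewrite lee_fin exprn_ge0.
have n2 t : (0 <= (X k j t ^+ 2)%:E)%E by rewrite lee_fin sqr_ge0.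
have : (\int[P]_t (3%:E * (X k j t ^+ 2)%:E) <= \int[P]_t (1%:E + 2%:E * (`|X k j t| ^+ 3)%:E))%E.
  apply: ge0_le_integral => //.
  - by move=> t _; rewrite mule_ge0.
  - exact: measurable_funeM.
  - by apply: emeasurable_funD => //; exact: measurable_funeM.
  - move=> t _; rewrite -!EFinM -EFinD lee_fin.
    have := @amgm_pow R 1 `|X k j t| 1; rewrite normr_ge0 ler01 => /(_ isT isT).
    by rewrite !expr1n !mulr1 real_normK ?num_real// addrC.
have m23 : measurable_fun setT (fun t => 2%:E * (`|X k j t| ^+ 3)%:E)%E by exact: measurable_funeM.
have n23 t : (0 <= 2%:E * (`|X k j t| ^+ 3)%:E)%E by rewrite mule_ge0.
rewrite ge0_integralZl// ge0_integralD// ge0_integralZl// h2 integral_cst//= probability_setT !mule1.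
move=> /le_trans /(_ (leeD2l _ (lee_wpmul2l _ h3))).
rewrite -EFinM -EFinD !lee_fin ler0n => /(_ isT); lra.
Qed.

Lemma bgu_moments k j : two_variable_ensembles bit_gaussian_or_uniform X -> j != ord0 ->
  (\int[P]_t (`|X k j t| ^+ 4)%:E <= 9%:E)%E /\ \int[P]_t (X k j t ^+ 3) = 0.
Proof.
move=> X2 j0; have [_ Xk] := X2 k.
have [i1 e1] := ens_orthonormal X_ens j ord0.
have [i2 e2] := ens_orthonormal X_ens j j.
have E1 : \int[P]_t X k j t = 0.
  rewrite (negPf j0) in e1; rewrite -[RHS]e1; apply: eq_Rintegral => t _.
  by rewrite (ens_one X_ens) mulr1.
have E2 : \int[P]_t (X k j t ^+ 2) = 1.
  by rewrite eqxx in e2; rewrite -[RHS]e2; apply: eq_Rintegral => t _; rewrite expr2.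
have I2 : P.-integrable setT (EFin \o (fun t => X k j t ^+ 2)).
  by apply: eq_integrable i2 => // t _ /=; rewrite expr2.
case: (Xk j j0) => h.
- exact: uniform_bit_moments.
- exact: standard_gaussian_moments.
- exact: uniform_sqrt3_moments.
Qed.

Lemma moment_bound_bgu k (eta : R) : two_variable_ensembles bit_gaussian_or_uniform X ->
  eta ^+ 2 = 3^-1 -> moment_bound P x 4 eta [set k]%SET.
Proof.
move=> X2 heta; apply: (moment_bound_coord4 X_ens heta) => v vk v0.
have [mk Xk] := X2 k.
have [c [j [j0 -> hv]]] := two_variables_eval mk vk v0.
have [h4 h3] := bgu_moments X2 j0.
have mZ4 : measurable_fun setT (fun t => (`|X k j t| ^+ 4)%:E).
  apply/measurable_EFinP; apply: measurable_funX.
  exact: (measurableT_comp (@normr_measurable R setT)).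
have n4 t : (0 <= (`|X k j t| ^+ 4)%:E)%E by rewrite lee_fin exprn_ge0.
have E t : ml_eval v (sample x t) = c * X k j t by rewrite hv// => i; exact: (ens_one X_ens).
split.
  have E4 t : `|ml_eval v (sample x t)| ^+ 4 = `|c| ^+ 4 * `|X k j t| ^+ 4.
    by rewrite E normrM exprMn.
  under eq_integral do rewrite E4 EFinM.
  rewrite ge0_integralZl//.
  have -> : (c ^+ 2) ^+ 2 = `|c| ^+ 4 by rewrite (exprM `|c| 2 2) real_normK ?num_real.
  rewrite mulrC (EFinM (`|c| ^+ 4)).
  by rewrite lee_wpmul2l ?lee_fin ?exprn_ge0.
under eq_Rintegral do rewrite E exprMn.
rewrite RintegralZl//; first by rewrite h3 mulr0.
by apply: integrable_exp3 => //; rewrite (le_lt_trans h4)// ltry.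
Qed.

(** Almost surely |V| is at most alpha^(-1/2) times its norm, so E |V|^3 is at most this bound times
    E V^2; hence K = alpha^(-1/2). *)
Lemma moment_bound_finite_space k (alpha : R) (Om : 'I_n -> finProbSpace R) :
  bases_of_finite_spaces X Om -> least_nonzero_mass Om alpha -> 0 < alpha -> alpha <= 2^-1 ->
  moment_bound P x 3 (2^-1 * alpha `^ (6^-1)) [set k]%SET.
Proof.
move=> XOm [_ _ hmin] a0 a12.
have a60 : 0 <= alpha `^ 6^-1 by exact: powR_ge0.
apply: (@moment_bound_coord3 _ _ _ _ _ _ _ X_ens k _ (Num.sqrt alpha)^-1).
- rewrite mulr_ge0// ler_piMr//.
  have : alpha `^ 6^-1 <= 1 `^ 6^-1 by rewrite ge0_ler_powR ?nnegrE ?(ltW a0)//; lra.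
  by rewrite powR1.
(* The exponent 1/6 is chosen for this product: eta^3 K = 1/8. *)
- rewrite exprMn -[(alpha `^ _) ^+ 3]powR_mulrn// -powRrM (_ : 6^-1 * 3%:R = 2^-1 :> R); last by lra.
  rewrite powR12_sqrt ?(ltW a0)// mulfK ?gt_eqF ?sqrtr_gt0//.
  by rewrite exprSr expr2; lra.
move=> v vk v0; have [W [f [hW _ hf]]] := XOm k.
set b := Num.sqrt (ml_norm2 v); have b0 : 0 <= b by exact: sqrtr_ge0.
have c0 : 0 <= (Num.sqrt alpha)^-1 * b by rewrite mulr_ge0// invr_ge0 sqrtr_ge0.
have [iV2 eV2] := coord_sqr X_ens vk.
pose g w := \sum_b v b * f (b k) w.
have Vg t : ml_eval v (sample x t) = g (W t).
  rewrite (coord_eval X_ens t vk); apply: eq_bigr => s _.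
  by rewrite -hf.
have mV : measurable_fun setT (fun t => ml_eval v (sample x t)).
  by apply: measurable_ml_eval => i j; exact: ens_measurable.
have mV2 : measurable_fun setT (fun t => (ml_eval v (sample x t) ^+ 2)%:E).
  by apply/measurable_EFinP; exact: measurable_funX.
have EV2 : (\int[P]_t (ml_eval v (sample x t) ^+ 2)%:E = (ml_norm2 v)%:E)%E.
  by rewrite -eV2 /Rintegral fineK//; exact: integrable_fin_num iV2.
(* An atom of mass at least alpha carries at most the whole second moment. *)
have gb w : fps_mass w != 0 -> `|g w| <= (Num.sqrt alpha)^-1 * b.
  move=> w0; have [mw Pw] := hW w.
  have h : ((g w ^+ 2 * fps_mass w)%:E <= (ml_norm2 v)%:E)%E.
    rewrite -EV2; apply: (@le_trans _ _ (\int[P]_(t in W @^-1` [set w]) (ml_eval v (sample x t) ^+ 2)%:E)%E).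
      rewrite (eq_integral (fun=> (g w ^+ 2)%:E)); last first.
        by move=> t; rewrite inE /= => <-; rewrite Vg.
      by rewrite integral_cst//= Pw EFinM.
    by apply: ge0_subset_integral => // t _; rewrite lee_fin sqr_ge0.
  rewrite lee_fin in h.
  have h' : g w ^+ 2 * alpha <= b ^+ 2.
    rewrite sqr_sqrtr ?ml_norm2_ge0// (le_trans _ h)// ler_wpM2l ?sqr_ge0//.
    exact: hmin.
  have sa : 0 < Num.sqrt alpha by rewrite sqrtr_gt0.
  rewrite mulrC ler_pdivlMr// -(@ler_pXn2r _ 2) ?nnegrE ?mulr_ge0 ?sqrtr_ge0//.
  by rewrite exprMn real_normK ?num_real// sqr_sqrtr ?(ltW a0).
have aeV : {ae P, forall t, `|ml_eval v (sample x t)| <= (Num.sqrt alpha)^-1 * b}.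
  (* Values of [g] on atoms of mass zero are uncontrolled; the points sent to such atoms form a null
     set. *)
  pose N := \big[setU/set0]_(w : Om k | fps_mass w == 0) (W @^-1` [set w]).
  have NN : P.-negligible N.
    rewrite /N; elim/big_ind : _ => [|A B|w /eqP w0].
    - exact: negligible_set0.
    - exact: negligibleU.
    - by have [mw Pw] := hW w; apply/negligibleP => //; rewrite /= Pw w0.
  apply: negligibleS NN => t /=; apply: contra_notP => ht.
  rewrite Vg; apply: gb; apply/negP => w0; apply: ht.
  by rewrite /N (bigD1 (W t))//=; left.
apply: (@le_trans _ _ (\int[P]_t (((Num.sqrt alpha)^-1 * b)%:E * (ml_eval v (sample x t) ^+ 2)%:E))%E).
  apply: ae_ge0_le_integral => //.
  - by apply/measurable_EFinP; apply: measurable_funX; exact: (measurableT_comp (@normr_measurable R setT)).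
  - by move=> t _; rewrite -EFinM lee_fin mulr_ge0 ?sqr_ge0.
  - exact: measurable_funeM.
  - apply: filterS aeV => t h _; rewrite -EFinM lee_fin exprS real_normK ?num_real//.
    by rewrite ler_wpM2r ?sqr_ge0.
rewrite ge0_integralZl//.
- rewrite EV2 -EFinM lee_fin -mulrA ler_wpM2l ?invr_ge0 ?sqrtr_ge0//.
  by rewrite exprSr mulrC sqr_sqrtr ?ml_norm2_ge0.
- by move=> t _; rewrite lee_fin sqr_ge0.
Qed.

End OneCoordinateLaws.

(** * The four hypotheses *)

Section Matching.
Context {R : realType} {n : nat} {m : 'I_n -> nat}.

(* Junk value 0 on sequences of size at least 3. *)
Definition orthonormal_moment k (S : seq 'I_k.+1) : R :=
  match S with
  | [::] => 1
  | [:: j] => (j == ord0)%:R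
  | [:: j; j'] => (j == j')%:R
  | _ => 0
  end.

(** Moments of order at most 2 are dictated by orthonormality, so moments below order 3 match
    automatically under H2 and H3. *)
Lemma orthonormal_momentE {d} {T : measurableType d} {P : probability T R} (X : ensembles P m)
    (i : 'I_n) (S : seq 'I_(m i).+1) : ensemble_sequence X -> (size S < 3)%N ->
  ('E_P[fun t => (\prod_(j <- S) X i j t)%R] = (orthonormal_moment S)%:E)%E.
Proof.
move=> X_ens; case: S => [|j [|j' [|//]]] _ /=.
- under eq_fun do rewrite big_nil.
  exact: expectation_cst.
- rewrite -((X_ens.1 i).2 j ord0); congr expectation; apply/funext => t.
  by rewrite big_seq1 (X_ens.1 i).1 mulr1.
- rewrite -((X_ens.1 i).2 j j'); congr expectation; apply/funext => t.
  by rewrite big_cons big_seq1.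
Qed.

(** The value shared by bits, Gaussians and uniform variables: a trivial index reduces a third
    moment to a second one, and three nontrivial indices give zero. *)
Definition symmetric_moment k (S : seq 'I_k.+1) : R :=
  match S with
  | [:: a; b; c] => if a == ord0 then (b == c)%:R else if b == ord0 then (a == c)%:R
                    else if c == ord0 then (a == b)%:R else 0
  | _ => orthonormal_moment S
  end.

Lemma bgu_momentE {d} {T : measurableType d} {P : probability T R} (X : ensembles P m)
    (i : 'I_n) (S : seq 'I_(m i).+1) : ensemble_sequence X ->
  two_variable_ensembles bit_gaussian_or_uniform X -> (size S < 4)%N ->
  ('E_P[fun t => (\prod_(j <- S) X i j t)%R] = (symmetric_moment S)%:E)%E.
Proof.
move=> X_ens X2; case: S => [|a [|b [|c [|//]]]] _; try exact: orthonormal_momentE.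
have one t : X i ord0 t = 1 := (X_ens.1 i).1 t.
rewrite /symmetric_moment; case: eqVneq => [->|a0].
  rewrite -((X_ens.1 i).2 b c); congr expectation; apply/funext => t.
  by rewrite 2!big_cons big_seq1 one mul1r.
case: eqVneq => [->|b0].
  rewrite -((X_ens.1 i).2 a c); congr expectation; apply/funext => t.
  by rewrite 2!big_cons big_seq1 one mul1r.
case: eqVneq => [->|c0].
  rewrite -((X_ens.1 i).2 a b); congr expectation; apply/funext => t.
  by rewrite 2!big_cons big_seq1 one mulr1.
have [mi _] := X2 i.
(* With two variables per ensemble, three nontrivial indices coincide and the moment is a third
   power. *)
have eq1 (u : 'I_(m i).+1) : u != ord0 -> nat_of_ord u = 1%N.
  have : (nat_of_ord u <= 1)%N by rewrite -[leqRHS]mi -ltnS ltn_ord.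
  by rewrite -val_eqE /=; case: (nat_of_ord u) => [|[|]].
have -> : b = a by apply/val_inj; rewrite /= !eq1.
have -> : c = a by apply/val_inj; rewrite /= !eq1.
have [h4 h3] := bgu_moments X_ens X2 a0.
have i3 : P.-integrable setT (EFin \o (fun t => X i a t ^+ 3)).
  by apply: integrable_exp3; [exact: measurable_funPT|rewrite (le_lt_trans h4)// ltry].
rewrite -h3 unlock /Rintegral fineK; last exact: integrable_fin_num i3.
by apply: eq_integral => t _; rewrite 2!big_cons big_seq1 exprS expr2.
Qed.

End Matching.

(** Checked by hand up to 4; from there on (D + 1)/D <= 5/4. *)
Lemma third_le_pow (R : realFieldType) (D : nat) : D%:R / 3 <= (5 / 4) ^+ D :> R.
Proof.
have small : forall D' : nat, (D' <= 4)%N -> D'%:R / 3 <= (5 / 4) ^+ D' :> R.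
  by case=> [|[|[|[|[|]]]]] // _; rewrite ?exprS ?expr0; lra.
have [/small//|] := leqP D 4; elim: D => // D ih; rewrite ltnS => D4.
have {}ih : D%:R / 3 <= (5 / 4) ^+ D :> R.
  by move: D4; rewrite leq_eqVlt => /predU1P[<-|/ih//]; exact: small.
have : 4 <= D%:R :> R by rewrite ler_nat.
rewrite exprS -[D.+1%:R]natr1; lra.
Qed.

Lemma pow_third_le (R : realFieldType) (D : nat) (g h : R) : 0 <= g -> 5 / 4 * g <= h ->
  D%:R / 3 * g ^+ D <= h ^+ D.
Proof.
move=> g0 gh; apply: (@le_trans _ _ ((5 / 4) ^+ D * g ^+ D)).
  by rewrite ler_wpM2r ?exprn_ge0// third_le_pow.
have g54 : 0 <= 5 / 4 * g by rewrite mulr_ge0// divr_ge0.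
by rewrite -exprMn lerXn2r ?nnegrE// (le_trans g54).
Qed.

(** Bernoulli's inequality: (10/9)^D >= 1 + D/9 >= D/12. *)
Lemma pow_twelfth_le (R : realFieldType) (D : nat) : D%:R / 12 * 9 ^+ D <= 10 ^+ D :> R.
Proof.
have h : 1 + D%:R / 9 <= (10 / 9) ^+ D :> R.
  elim: D => [|D ih]; first by rewrite mul0r addr0 expr0.
  have D0 : 0 <= D%:R :> R by [].
  by rewrite exprS -[D.+1%:R]natr1; nra.
have D0 : 0 <= D%:R :> R by [].
rewrite (_ : 10 = 10 / 9 * 9 :> R); last by field.
by rewrite exprMn ler_wpM2r ?exprn_ge0//; lra.
Qed.

Theorem theorem3p18 (R : realType) (n : nat) (m : 'I_n -> nat)
  (dX dY : measure_display) (TX : measurableType dX) (TY : measurableType dY)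
  (PX : probability TX R) (PY : probability TY R)
  (X : ensembles PX m) (Y : ensembles PY m) (Q : mlpoly R m)
  (r d : nat) (eta tau B : R) (Psi : R -> R)
  (n_gt0 : (0 < n)%N)
  (X_ens : ensemble_sequence X) (Y_ens : ensemble_sequence Y)
  (Q_var : ml_var Q <= 1) (Q_deg : (ml_deg Q <= d)%N)
  (Q_inf : forall i, ml_inf Q i <= tau)
  (Psi_Cr : Cr_function r Psi)
  (Psi_bound : forall x, `|(Psi^`(r))%classic x| <= B) :
  let gap := expectation_gap PX PY (Psi \o ml_subst Q X) (Psi \o ml_subst Q Y) in
  [/\ hypothesis_H1 X Y r eta ->
        (gap <= ((2 * B / r`!%:R) * d%:R * eta ^- (r * d)
                   * tau `^ (r%:R / 2 - 1))%:E)%E,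
      forall beta : R, hypothesis_H2 X Y r eta beta ->
        (gap <= (B * 30 ^+ d * beta ^+ d * tau `^ (2^-1))%:E)%E,
      forall alpha : R, hypothesis_H3 X Y r eta alpha ->
        (gap <= (B * (10 * alpha `^ (- 2^-1)) ^+ d * tau `^ (2^-1))%:E)%E
    & hypothesis_H4 X Y r eta ->
        (gap <= (B * 10 ^+ d * tau)%:E)%E].
Proof.
move=> gap.
have B0 : 0 <= B := le_trans (normr_ge0 _) (Psi_bound 0).
have tau0 : 0 <= tau.
  by apply: le_trans (Q_inf (Ordinal n_gt0)); apply: sumr_ge0 => s _; exact: sqr_ge0.
have inv := fun r3 heta mom hX hY => @invariance R n m dX dY TX TY PX PY X Y Q r d eta tau B Psi
  n_gt0 X_ens Y_ens Q_var Q_deg Q_inf Psi_Cr Psi_bound r3 heta mom hX hY.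
have mom3 : matching_moments X Y 3 by move=> i S S3; rewrite !orthonormal_momentE.
have tensor dT (T : measurableType dT) (P : probability T R) (Z : ensembles P m) r' eta' :
    ensemble_sequence Z -> (2 <= r')%N ->
    (forall k, moment_bound P (fun i j => Z i j : T -> R) r' eta' [set k]%SET) ->
    moment_bound P (fun i j => Z i j : T -> R) r' eta' [set: 'I_n]%SET.
  move=> Z_ens; apply: moment_bound_tensor; [exact: ens_measurable|exact: Z_ens.2|exact: ens_one].
(* The factor d/3 costs 5/4 in the base: eta^-3 is 16 sqrt(2) beta < (4/5) 30 beta under H2,
   and 8 alpha^(-1/2) = (4/5) 10 alpha^(-1/2) under H3. *)
have final3 (g h : R) : r = 3%N -> 0 <= g -> 5 / 4 * g <= h -> eta ^- 3 = g ->
    2 * B / r`!%:R * d%:R * eta ^- (r * d) * tau `^ (r%:R / 2 - 1) <= B * h ^+ d * tau `^ 2^-1.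
  move=> -> g0 gh etag.
  rewrite (_ : 3%:R / 2 - 1 = 2^-1 :> R); last by lra.
  rewrite ler_wpM2r ?powR_ge0// exprM -exprVn etag.
  have -> : 2 * B / 3`!%:R * d%:R * g ^+ d = B * (d%:R / 3 * g ^+ d).
    by rewrite !factS fact0; field.
  by rewrite ler_wpM2l// pow_third_le.
split.
- move=> [r3 hX hY mom]; have r2 := ltnW r3; have [_ /andP[eta0 eta1] _] := hX.
  by apply: inv => //; [rewrite eta0 ltW|exact: moment_bound_hypercontractive
    |exact: moment_bound_hypercontractive].
- move=> beta [r3 X2 Y2 etaE].
  have beta1 : 1 <= beta.
    have [mi _] := X2 (Ordinal n_gt0).
    by apply: (bounded_third_moment_ge1 X2 (k := Ordinal n_gt0)); rewrite mi.
  have beta0 : 0 < beta by rewrite (lt_le_trans ltr01).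
  have s2 : 0 < Num.sqrt 2 :> R by rewrite sqrtr_gt0.
  have eta_gt0 : 0 < eta by rewrite etaE mulr_gt0 ?powR_gt0.
  (* The power of 2 alone is below 1/2, and beta^(-1/3) <= 1 since beta >= 1. *)
  have eta12 : eta <= 2^-1.
    rewrite etaE -[leRHS]mulr1 ler_pM ?powR_ge0//.
      have : 2 `^ (- (3 / 2)) <= 2 `^ (- 1) :> R.
        by apply: ler_powR; [rewrite ler1n|rewrite lerN2 ler_pdivlMr// mul1r ler_nat].
      by rewrite [leRHS]powR_inv1.
    have : beta `^ (- 3^-1) <= beta `^ 0 by apply: ler_powR => //; rewrite oppr_le0 invr_ge0.
    by rewrite powRr0.
  have sqrt2_ge1 : 1 <= Num.sqrt 2 :> R by rewrite -[leLHS]sqrtr1 ler_wsqrtr// ler1n.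
  have sqrt2_le : Num.sqrt 2 <= 3 / 2 :> R.
    rewrite -(@ler_pXn2r _ 2) ?nnegrE ?sqrtr_ge0 ?divr_ge0// sqr_sqrtr//; lra.
  (* 2^(-9/2) = 1 / (16 sqrt(2)). *)
  have eta3 : eta ^+ 3 = (16 * Num.sqrt 2 * beta)^-1.
    have e2 : (2 `^ (- (3 / 2))) ^+ 3 = (16 * Num.sqrt 2)^-1 :> R.
      rewrite -powR_mulrn ?powR_ge0// -powRrM (_ : - (3 / 2) * 3%:R = - (4%:R + 2^-1) :> R); last by lra.
      rewrite powRN powRD; last by rewrite pnatr_eq0 implybT.
      by rewrite powR_mulrn// powR12_sqrt// !exprS expr0; congr (_ * _)^-1; ring.
    have eb : (beta `^ (- 3^-1)) ^+ 3 = beta^-1.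
      by rewrite -powR_mulrn ?powR_ge0// -powRrM mulNr mulVf ?pnatr_eq0// powR_inv1 ?(ltW beta0).
    by rewrite etaE exprMn e2 eb [RHS]invfM.
  have eta3b : eta ^+ 3 * beta <= 2^-1.
    rewrite eta3 invfM mulfVK ?gt_eqF// lef_pV2 ?posrE ?mulr_gt0//; lra.
  apply: (@le_trans _ _ (2 * B / r`!%:R * d%:R * eta ^- (r * d) * tau `^ (r%:R / 2 - 1))%:E)%E.
    apply: inv; rewrite ?r3//.
    + by rewrite eta_gt0 (le_trans eta12)//; lra.
    + by apply: tensor => // k; apply: (moment_bound_third_moment X_ens X2); rewrite ?(ltW eta_gt0).
    + by apply: tensor => // k; apply: (moment_bound_third_moment Y_ens Y2); rewrite ?(ltW eta_gt0).
  rewrite lee_fin -[B * _ * _]mulrA -exprMn; apply: (final3 _ _ r3 _ _ (congr1 GRing.inv eta3)).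
  + by rewrite invrK !mulr_ge0 ?sqrtr_ge0 ?(ltW beta0).
  + rewrite invrK mulrA ler_wpM2r ?(ltW beta0)//; lra.
- move=> alpha [r3 [Om [XOm hmin]] a12 etaE hY].
  (* [alpha] is an attained mass, hence nonnegative, and nonzero by definition. *)
  have a0 : 0 < alpha.
    have [an0 [i [w wE]] _] := hmin.
    by rewrite lt_neqAle eq_sym an0 -wE fps_mass_ge0.
  have eta_gt0 : 0 < eta by rewrite etaE mulr_gt0 ?powR_gt0.
  have [_ /andP[_ eta1] _] := hY.
  have eta3 : eta ^- 3 = 8 * alpha `^ (- 2^-1).
    rewrite etaE exprMn -[(alpha `^ _) ^+ 3]powR_mulrn ?powR_ge0// -powRrM.
    rewrite (_ : 6^-1 * 3%:R = 2^-1 :> R); last by lra.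
    by rewrite invfM -powRN -exprVn invrK !exprS expr0; congr (_ * _); ring.
  apply: (@le_trans _ _ (2 * B / r`!%:R * d%:R * eta ^- (r * d) * tau `^ (r%:R / 2 - 1))%:E)%E.
    apply: inv; rewrite ?r3//.
    + by rewrite eta_gt0 ltW.
    + by apply: tensor => // k; rewrite etaE; exact: (moment_bound_finite_space X_ens XOm hmin a0 a12).
    + exact: moment_bound_hypercontractive.
  rewrite lee_fin; apply: (final3 _ _ r3 _ _ eta3).
  + by rewrite mulr_ge0 ?powR_ge0.
  + by rewrite mulrA ler_wpM2r ?powR_ge0//; lra.
- move=> [r4 etaE X2 Y2].
  have eta_gt0 : 0 < eta by rewrite etaE powR_gt0.
  have eta2 : eta ^+ 2 = 3^-1.
    by rewrite etaE -powR_mulrn ?powR_ge0// -powRrM mulNr mulVf ?pnatr_eq0// powR_inv1.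
  have eta1 : eta <= 1.
    have : 3 `^ (- 2^-1) <= 3 `^ 0 :> R.
      by apply: ler_powR; [rewrite ler1n|rewrite oppr_le0 invr_ge0].
    by rewrite powRr0 -etaE.
  apply: (@le_trans _ _ (2 * B / r`!%:R * d%:R * eta ^- (r * d) * tau `^ (r%:R / 2 - 1))%:E)%E.
    apply: inv; rewrite ?r4//.
    + by rewrite eta_gt0.
    + by move=> i S S4; rewrite !bgu_momentE.
    + by apply: tensor => // k; exact: moment_bound_bgu.
    + by apply: tensor => // k; exact: moment_bound_bgu.
  (* eta^(-4) = 9, and d/12 <= (10/9)^d. *)
  rewrite lee_fin r4 (_ : 4%:R / 2 - 1 = 1 :> R); last by lra.
  rewrite powRr1// ler_wpM2r// exprM (exprM _ 2 2) eta2 -exprVn.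
  have -> : 2 * B / 4`!%:R * d%:R * (3^-1 ^+ 2)^-1 ^+ d = B * (d%:R / 12 * 9 ^+ d).
    rewrite (_ : (3^-1 ^+ 2)^-1 = 9); last by field.
    by rewrite !factS fact0; field.
  by rewrite ler_wpM2l// pow_twelfth_le.
Qed.
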